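(* Let $N\ge 3$ and $p>2^*-1=\frac{N+2}{N-2}$. Then the problem $$\nabla\cdot\left[\frac{\nabla u}{\sqrt{1-|\nabla u|^2}}\right]+u^p=0\ \text{ in }\mathbb{R}^N,\qquad u(x)>0\ \text{ in }\mathbb{R}^N,\qquad u(x)\to 0\ \text{ as }|x|\to\infty$$ has infinitely many radial solutions not belonging to $\mathcal{D}^{1,2}(\mathbb{R}^N)$.
   Context: Here $2^*=\frac{2N}{N-2}$, and $\mathcal{D}^{1,2}(\mathbb{R}^N)$ is the completion of $C_c^\infty(\mathbb{R}^N)$ with respect to the norm $\|\nabla u\|_{L^2(\mathbb{R}^N)}$. Solutions are understood in the classical sense, with $|\nabla u|<1$ everywhere. A radial function $u$ on $\mathbb{R}^N$ is identified with a function of $r=|x|$; radial solutions correspond to global positive functions $u(r)$, $r\ge 0$, vanishing at infinity, with $|u'|<1$, $u'(0)=0$ and $$\left(\frac{u'}{\sqrt{1-(u')^2}}\right)'+\frac{N-1}{r}\frac{u'}{\sqrt{1-(u')^2}}+u^p=0\quad\text{for } r>0.$$ *)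

(* Defs.v *)
From HB Require Import structures.
From mathcomp Require Import all_boot all_order all_algebra.
From mathcomp Require Import all_classical all_reals all_analysis.

Set Implicit Arguments.
Unset Strict Implicit.
Unset Printing Implicit Defensive.

Import Order.TTheory GRing.Theory Num.Theory.
Import numFieldNormedType.Exports.

Local Open Scope classical_set_scope.
Local Open Scope ring_scope.

(* Points of R^N are row vectors.  The library norm on 'rV[R]_N is the sup norm
   (it gives the usual topology), so the Euclidean norm is defined here. *)
Section euclidean_calculus.
Context {R : realType} {N : nat}.
Implicit Types (u phi : 'rV[R]_N -> R) (F : 'rV[R]_N -> 'rV[R]_N) (x : 'rV[R]_N).

Definition enorm x : R := Num.sqrt (\sum_(i < N) x 0 i ^+ 2).

Definition partial (i : 'I_N) u x : R := 'D_(delta_mx 0 i) u x.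

Definition grad u x : 'rV[R]_N := \row_(i < N) partial i u x.

Definition div F x : R := \sum_(i < N) partial i (fun y => F y 0 i) x.

(* [partial] takes an arbitrary value where the derivative does not exist, hence
   the explicit derivability requirement. *)
Fixpoint Ck (k : nat) u : Prop :=
  continuous u /\
  match k with
  | 0 => True
  | k'.+1 => forall i : 'I_N,
      (forall x, derivable u x (delta_mx 0 i)) /\ Ck k' (partial i u)
  end.

Definition test_function phi : Prop :=
  (forall k, Ck k phi) /\ compact (closure [set x | phi x != 0]).

Definition radial u : Prop := exists v : R -> R, forall x, u x = v (enorm x).

Definition vanishes_at_infinity u : Prop :=
  forall e : R, 0 < e -> exists M : R, forall x, M < enorm x -> `|u x| < e.

Definition flux u x : 'rV[R]_N :=
  (Num.sqrt (1 - enorm (grad u x) ^+ 2))^-1 *: grad u x.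

Definition classical_solution (p : R) u : Prop :=
  [/\ Ck 2 u,
      forall x, enorm (grad u x) < 1,
      forall x, div (flux u) x + u x `^ p = 0,
      forall x, 0 < u x
    & vanishes_at_infinity u].

End euclidean_calculus.

Section tuple_cons.
Context {R : realType} (n : nat).
Local Notation T := (measurableTypeR R).

Definition tcons (xt : T * n.-tuple T) : n.+1.-tuple T :=
  [tuple of xt.1 :: xt.2].

Lemma measurable_tcons : measurable_fun [set: T * n.-tuple T] tcons.
Proof. by apply: measurable_cons. Qed.

Section step.
Variable mu : {sigma_finite_measure set (n.-tuple T) -> \bar R}.
Local Open Scope ereal_scope.

Definition lebesgue_step : set (n.+1.-tuple T) -> \bar R :=
  pushforward ((@lebesgue_measure R) \x mu) tcons.

Let step0 : lebesgue_step set0 = 0.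
Proof. by rewrite /lebesgue_step /pushforward preimage_set0 measure0. Qed.

Let step_ge0 A : 0 <= lebesgue_step A.
Proof. by rewrite /lebesgue_step /pushforward measure_ge0. Qed.

Let step_sigma_additive : semi_sigma_additive lebesgue_step.
Proof.
move=> F mF tF mUF; rewrite /lebesgue_step /pushforward preimage_bigcup.
apply: measure_semi_sigma_additive.
- by move=> n0; rewrite -[X in measurable X]setTI; exact: measurable_tcons.
- apply/trivIsetP => /= i j _ _ ij; rewrite -preimage_setI.
  by move/trivIsetP : tF => /(_ _ _ _ _ ij) ->//; rewrite preimage_set0.
- by rewrite -preimage_bigcup -[X in measurable X]setTI; exact: measurable_tcons.
Qed.

HB.instance Definition _ := isMeasure.Build _ _ _ lebesgue_step
  step0 step_ge0 step_sigma_additive.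

Lemma lebesgue_step_sigma_finite : sigma_finite [set: n.+1.-tuple T] lebesgue_step.
Proof.
have /sigma_finiteP[F [TF ndF Foo]] := sigma_finiteT (@lebesgue_measure R).
have /sigma_finiteP[G [TG ndG Goo]] := sigma_finiteT mu.
pose h (t : n.+1.-tuple T) : T * n.-tuple T := (thead t, [tuple of behead t]).
have hK xt : h (tcons xt) = xt.
  case: xt => x t; rewrite /h /tcons/=.
  by congr pair; exact: val_inj.
have mh : measurable_fun setT h.
  apply/measurable_fun_pair; [exact: measurable_tnth|exact: measurable_behead].
exists (fun k => h @^-1` (F k `*` G k)).
  apply/seteqP; split => // t _.
  have [i _ Fi] : (\bigcup_i F i) (h t).1 by rewrite -TF.
  have [j _ Gj] : (\bigcup_i G i) (h t).2 by rewrite -TG.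
  exists (maxn i j) => //=; split.
    by apply/(subsetPset _ _ (ndF _ _ (leq_maxl i j))).
  by apply/(subsetPset _ _ (ndG _ _ (leq_maxr i j))).
move=> k; have [mF Fk] := Foo k; have [mG Gk] := Goo k; split.
  by rewrite -[X in measurable X]setTI; apply: mh => //; exact: measurableX.
rewrite /lebesgue_step /pushforward.
have -> : tcons @^-1` (h @^-1` (F k `*` G k)) = F k `*` G k.
  by apply/funext => xt; rewrite /preimage /mkset hK.
by rewrite product_measure1E// lte_mul_pinfty// ge0_fin_numE.
Qed.

HB.instance Definition _ :=
  Measure_isSigmaFinite.Build _ _ _ lebesgue_step lebesgue_step_sigma_finite.

End step.
End tuple_cons.

(* N-dimensional Lebesgue measure, on N-tuples (which carry the product
   sigma-algebra): the image of lebesgue_measure \x lebesgueN n under cons. *)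
Fixpoint lebesgueN (R : realType) (n : nat) :
    {sigma_finite_measure set (n.-tuple (measurableTypeR R)) -> \bar R} :=
  match n return {sigma_finite_measure set (n.-tuple (measurableTypeR R)) -> \bar R}
  with
  | 0 => @dirac _ (0.-tuple (measurableTypeR R)) [tuple] R
  | n'.+1 => lebesgue_step (lebesgueN R n')
  end.

Definition sobolev_exponent (R : realType) (N : nat) : R :=
  (2 * N%:R) / (N%:R - 2).

Section homogeneous_sobolev.
Context {R : realType} {N : nat}.
Implicit Types u : 'rV[R]_N -> R.

Definition on_tuples u (t : N.-tuple (measurableTypeR R)) : R :=
  u (\row_(i < N) tnth t i).

Definition LpN (q : R) u : \bar R :=
  ('N[lebesgueN R N]_(q%:E)[EFin \o on_tuples u])%E.

Definition grad_norm u : \bar R := LpN 2 (fun x => enorm (grad u x)).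

(* The completion of C_c^oo for |grad phi|_{L^2} is realized as a space of
   functions through the Sobolev embedding: u stands for the class of a
   gradient-Cauchy sequence of test functions converging to u in L^{2^*}. *)
Definition in_D12 u : Prop :=
  measurable_fun setT (on_tuples u) /\
  exists phi : nat -> 'rV[R]_N -> R,
    [/\ forall k, test_function (phi k),
        forall e : R, 0 < e -> exists K : nat, forall j k,
          (K <= j)%N -> (K <= k)%N ->
          (grad_norm (phi j \- phi k)%R < e%:E)%E
      & LpN (sobolev_exponent R N) (phi k \- u) @[k --> \oo] --> 0%E].

End homogeneous_sobolev.

(* Main.v *)
(* Writing [G = r^-1 u' / sqrt (1 - u'^2)], a radial solution of height [xi] solves
     [u' = r G / sqrt (1 + (r G)^2)],   [r G' = - N G - u^p],   [u 0 = xi],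
   a system with globally Lipschitz right-hand side once [u^p] is replaced by a
   truncated power; it is solved by Picard iteration in a weighted sup norm.
   With [V = r G], the energy [E = sqrt (1 + V^2) - 1 + u^(p+1) / (p+1)] is
   nonincreasing, and for [c = N / (p+1)] the Pohozaev functional
   [P = r^N E + c r^(N-1) u V] has [P' = r^(N-1) V^2/q (N q/(q+1) - (N-1) + c)],
   [q = sqrt (1 + V^2)].  Supercriticality means [c < N/2 - 1], so for small [xi]
   the energy bound keeps [q] close to [1] and [P' < 0].  Then [P < 0], which
   excludes zeros of [u] and gives [u^2 >= k r^(2-N)]: the mass of [u^(2N/(N-2))]
   on far cubes [[b, 2 b]^N] does not tend to [0], so [u] is not a limit of test
   functions.  Distinct heights [xi] give distinct solutions. *)
Require Import Defs.
From mathcomp Require Import all_boot all_order all_algebra.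
From mathcomp Require Import all_classical all_reals all_analysis.
From mathcomp Require Import ring lra.

Set Implicit Arguments.
Unset Strict Implicit.
Unset Printing Implicit Defensive.

Import Order.TTheory GRing.Theory Num.Theory.
Import numFieldNormedType.Exports.

Local Open Scope classical_set_scope.
Local Open Scope ring_scope.

(** * Calculus on the half-line *)

Section pointwise_continuity.
Context {R : realType} {T : topologicalType}.
Implicit Types (f g : T -> R) (x : T).

Lemma pcont_cst (c : R) x : {for x, continuous (fun=> c)}.
Proof. exact: cst_continuous. Qed.

Lemma pcontD f g x : {for x, continuous f} -> {for x, continuous g} ->
  {for x, continuous (fun t => f t + g t)}.
Proof. by move=> fx gx; apply: cvgD. Qed.

Lemma pcontB f g x : {for x, continuous f} -> {for x, continuous g} ->
  {for x, continuous (fun t => f t - g t)}.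
Proof. by move=> fx gx; apply: cvgB. Qed.

Lemma pcontN f x : {for x, continuous f} -> {for x, continuous (fun t => - f t)}.
Proof. by move=> fx; apply: cvgN. Qed.

Lemma pcontM f g x : {for x, continuous f} -> {for x, continuous g} ->
  {for x, continuous (fun t => f t * g t)}.
Proof. by move=> fx gx; apply: cvgM. Qed.

Lemma pcontV f x : f x != 0 -> {for x, continuous f} ->
  {for x, continuous (fun t => (f t)^-1)}.
Proof. by move=> f0 fx; apply: cvgV. Qed.

Lemma pcont_comp (h : R -> R) f x : {for x, continuous f} -> {for f x, continuous h} ->
  {for x, continuous (fun t => h (f t))}.
Proof. by move=> fx hx; exact: (@continuous_comp _ _ _ f h x fx hx). Qed.

Lemma pcontX f n x : {for x, continuous f} -> {for x, continuous (fun t => f t ^+ n)}.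
Proof.
move=> fx; apply: (@pcont_comp (fun y => y ^+ n) f x fx).
exact: exprn_continuous.
Qed.

End pointwise_continuity.

Section calculus.
Context {R : realType}.
Implicit Types (f g h df dh : R -> R).

Lemma derivable_continuous f (x l : R) : is_derive x 1 f l -> {for x, continuous f}.
Proof. by move=> fx; apply/differentiable_continuous/derivable1_diffP. Qed.

Lemma within_continuous f a b :
  (forall x, a <= x -> {for x, continuous f}) -> {within `[a, b], continuous f}.
Proof.
move=> cf; apply: continuous_in_subspaceT => x; rewrite inE /= in_itv /= => /andP[ax _].
exact: cf.
Qed.

Lemma is_derive_nondecreasing h dh a b : a <= b ->
  (forall x, a <= x -> {for x, continuous h}) ->
  (forall x, a < x < b -> is_derive x 1 h (dh x)) ->
  (forall x, a < x < b -> 0 <= dh x) -> h a <= h b.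
Proof.
rewrite le_eqVlt => /predU1P[-> //|ab] ch hd dh0.
have hd' x : x \in `]a, b[%R -> is_derive x 1 h (dh x).
  by rewrite in_itv /=; exact: hd.
have [c] := MVT ab hd' (within_continuous ch).
rewrite in_itv /= => cab; move/eqP; rewrite subr_eq => /eqP ->.
by rewrite lerDr mulr_ge0 ?dh0// subr_ge0 ltW.
Qed.

Lemma is_derive_increasing h dh a b : a < b ->
  (forall x, a <= x -> {for x, continuous h}) ->
  (forall x, a < x < b -> is_derive x 1 h (dh x)) ->
  (forall x, a < x < b -> 0 < dh x) -> h a < h b.
Proof.
move=> ab ch hd dh0.
have hd' x : x \in `]a, b[%R -> is_derive x 1 h (dh x).
  by rewrite in_itv /=; exact: hd.
have [c] := MVT ab hd' (within_continuous ch).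
rewrite in_itv /= => cab; move/eqP; rewrite subr_eq => /eqP ->.
by rewrite ltrDr mulr_gt0 ?dh0// subr_gt0.
Qed.

(** Both [g - f] and [g + f] are nondecreasing. This serves as mean value inequality throughout;
    derivatives are required on the open interval only, so the singular point [r = 0] may be an
    endpoint. *)
Lemma is_derive_norm_le f df g dg a b : a <= b ->
  (forall x, a <= x -> {for x, continuous f}) ->
  (forall x, a <= x -> {for x, continuous g}) ->
  (forall x, a < x < b -> is_derive x 1 f (df x)) ->
  (forall x, a < x < b -> is_derive x 1 g (dg x)) ->
  (forall x, a < x < b -> `|df x| <= dg x) ->
  `|f a| <= g a -> `|f b| <= g b.
Proof.
move=> ab cf cg fd gd dfg; rewrite !ler_norml => /andP[lo hi].
have H1 : (g \- f) a <= (g \- f) b.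
  apply: (@is_derive_nondecreasing _ (dg \- df)) => //.
  - by move=> x ax; apply: continuousB; [exact: cg|exact: cf].
  - by move=> x axb; apply: is_deriveB; [exact: gd|exact: fd].
  - by move=> x /dfg; rewrite ler_norml /= => /andP[]; lra.
have H2 : (g \+ f) a <= (g \+ f) b.
  apply: (@is_derive_nondecreasing _ (dg \+ df)) => //.
  - by move=> x ax; apply: continuousD; [exact: cg|exact: cf].
  - by move=> x axb; apply: is_deriveD; [exact: gd|exact: fd].
  - by move=> x /dfg; rewrite ler_norml /= => /andP[]; lra.
by move: H1 H2 => /=; lra.
Qed.

Lemma antiderivative f : continuous f -> exists F : R -> R,
  F 0 = 0 /\ forall x : R, 0 <= x -> is_derive x 1 F (f x).
Proof.
move=> cf.
(* The base point [-1] makes [0] interior, so that the derivative at [0] is two-sided. *)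
pose I x := (\int[lebesgue_measure]_(t in `[(-1 : R), x]) f t)%R.
exists (fun x => I x - I 0); split; first exact: subrr.
move=> x x0.
have [] := @continuous_FTC1_closed R f (-1) x (x + 1).
- by lra.
- apply: continuous_compact_integrable; first exact: segment_compact.
  exact: continuous_subspaceT.
- by lra.
- exact: cf.
move=> dI; rewrite derive1E => If.
have dIx : is_derive x 1 I (f x) by apply: DeriveDef => //.
by rewrite -[f x]subr0; apply: is_deriveB.
Qed.

End calculus.

(** * Radial averages *)

Section pointwise_derivatives.
Context {R : realType}.
Implicit Types (f g : R -> R) (x a b : R).

Lemma pderiv_cst c x : is_derive x 1 (fun=> c : R) 0.
Proof. exact: is_derive_cst. Qed.

Lemma pderivD f g x a b : is_derive x 1 f a -> is_derive x 1 g b ->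
  is_derive x 1 (fun t => f t + g t) (a + b).
Proof. by move=> fx gx; apply: is_deriveD. Qed.

Lemma pderivB f g x a b : is_derive x 1 f a -> is_derive x 1 g b ->
  is_derive x 1 (fun t => f t - g t) (a - b).
Proof. by move=> fx gx; apply: is_deriveB. Qed.

Lemma pderivM f g x a b : is_derive x 1 f a -> is_derive x 1 g b ->
  is_derive x 1 (fun t => f t * g t) (a * g x + f x * b).
Proof.
move=> fx gx; apply: (is_derive_eq (is_deriveM fx gx)).
by rewrite addrC; congr (_ + _); rewrite mulrC.
Qed.

Lemma pderivX f n x a : is_derive x 1 f a ->
  is_derive x 1 (fun t => f t ^+ n) (n%:R * f x ^+ n.-1 * a).
Proof.
move=> fx.
rewrite (_ : (fun t => f t ^+ n) = f ^+ n); last by apply/funext => t; rewrite exprfctE.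
exact: is_deriveX.
Qed.

Lemma pderiv_comp f g x a b : is_derive x 1 g b -> is_derive (g x) 1 f a ->
  is_derive x 1 (fun t => f (g t)) (a * b).
Proof. by move=> gx fx; apply: is_derive1_comp. Qed.

Lemma pderivV f x a : f x != 0 -> is_derive x 1 f a ->
  is_derive x 1 (fun t => (f t)^-1) (- a / f x ^+ 2).
Proof.
move=> f0 fx; apply: (is_derive_eq (is_deriveV f0 fx)).
by rewrite /GRing.scale /= mulNr mulNr mulrC.
Qed.

End pointwise_derivatives.

Section radial_average.
Context {R : realType}.
Implicit Types (gam Gam : R -> R).

(* [Gam r = r^-n * \int_0^r t^(n-1) gam t dt], stated as the equation that
   [Gam] satisfies away from the singular point [r = 0]. *)
Definition radial_average (n : nat) gam Gam :=
  [/\ continuous Gam, Gam 0 = gam 0 / n%:R &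
      forall r : R, 0 < r -> is_derive r 1 Gam ((gam r - n%:R * Gam r) / r)].

(** The function [t ^+ n * (Gam t - m / n%:R)] vanishes at [0] and has derivative
    [t ^+ n.-1 * (gam t - m)], which is nonnegative. *)
Lemma radial_average_ge n gam Gam r m : (0 < n)%N -> radial_average n gam Gam ->
  0 <= r -> (forall t, 0 <= t <= r -> m <= gam t) -> m / n%:R <= Gam r.
Proof.
move=> n0 [cG G0 dG]; have n0' : (0 < n%:R :> R) by rewrite ltr0n.
rewrite le_eqVlt => /predU1P[<- mg|r0 mg].
  by rewrite G0 ler_pM2r ?invr_gt0// mg ?lexx.
pose h t := t ^+ n * (Gam t - m / n%:R).
have : h 0 <= h r.
  apply: (@is_derive_nondecreasing _ _ (fun t => t ^+ n.-1 * (gam t - m))).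
  - exact: ltW.
  - move=> x _; apply: pcontM; first exact: exprn_continuous.
    by apply: pcontB; [exact: cG|exact: cst_continuous].
  - move=> x /andP[x0 xr].
    apply: (is_derive_eq (pderivM (pderivX n (is_derive_id x 1))
      (pderivB (dG x x0) (pderiv_cst _ x)))).
    rewrite /= /id; case: n n0 n0' {h cG G0 dG} => // n _ n0'; rewrite /= exprS.
    by field; rewrite !gt_eqF.
  - move=> x /andP[x0 xr]; rewrite mulr_ge0 ?exprn_ge0 ?subr_ge0 ?mg//.
      exact: ltW.
    by rewrite !ltW.
rewrite /h expr0n eqn0Ngt n0 mul0r pmulr_rge0 ?exprn_gt0// subr_ge0//.
Qed.

Lemma radial_averageN n gam Gam : radial_average n gam Gam ->
  radial_average n (fun t => - gam t) (fun t => - Gam t).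
Proof.
move=> [cG G0 dG]; split; first by move=> x; apply: continuousN; exact: cG.
  by rewrite G0 mulNr.
move=> r r0; apply: (is_derive_eq (is_deriveN (dG r r0))).
by rewrite mulrN -opprD mulNr.
Qed.

Lemma radial_averageB n gam1 Gam1 gam2 Gam2 :
  radial_average n gam1 Gam1 -> radial_average n gam2 Gam2 ->
  radial_average n (fun t => gam1 t - gam2 t) (fun t => Gam1 t - Gam2 t).
Proof.
move=> [c1 G1 d1] [c2 G2 d2]; split.
- by move=> x; apply: pcontB; [exact: c1|exact: c2].
- by rewrite G1 G2 mulrBl.
move=> r r0; apply: (is_derive_eq (pderivB (d1 r r0) (d2 r r0))).
by field; rewrite gt_eqF.
Qed.

Lemma radial_average_norm_le n gam Gam r M : (0 < n)%N -> radial_average n gam Gam ->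
  0 <= r -> (forall t, 0 <= t <= r -> `|gam t| <= M) -> `|Gam r| <= M / n%:R.
Proof.
move=> n0 gG r0 gM; rewrite ler_norml; apply/andP; split.
  rewrite -mulNr; apply: radial_average_ge gG _ _ => // t /gM.
  by rewrite ler_norml => /andP[].
rewrite -lerN2 -mulNr; apply: (radial_average_ge n0 (radial_averageN gG)) => // t /gM.
by rewrite lerN2 ler_norml => /andP[].
Qed.

(** Take [Phi r / r ^+ n] with [Phi] an antiderivative of [r ^+ n.-1 * gam r], extended by a
    constant to [r <= 0]; the delicate point is continuity at [0]. *)
Lemma radial_average_exists n gam : (0 < n)%N -> continuous gam ->
  exists Gam, radial_average n gam Gam.
Proof.
move=> n0 cg; have n0' : (0 < n%:R :> R) by rewrite ltr0n.
have cphi : continuous (fun x : R => x ^+ n.-1 * gam x).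
  by move=> x; apply: (@pcontM _ _ (fun x : R => x ^+ n.-1)); [exact: exprn_continuous|exact: cg].
have [Phi [Phi0 dPhi]] := antiderivative cphi.
pose Gam (r : R) := if r <= 0 then gam 0 / n%:R else Phi r / r ^+ n.
have GamE (r : R) : 0 < r -> Gam r = Phi r / r ^+ n by rewrite /Gam => r0; rewrite leNgt r0.
have G0 : Gam 0 = gam 0 / n%:R by rewrite /Gam lexx.
have dG (r : R) : 0 < r -> is_derive r 1 Gam ((gam r - n%:R * Gam r) / r).
  move=> r0; apply: (@near_eq_is_derive _ _ _ (fun r => Phi r / r ^+ n)).
  - near=> t; rewrite GamE//; near: t; exact: lt_nbhsr.
  - have rn0 : r ^+ n != 0 by rewrite expf_neq0// gt_eqF.
    rewrite GamE//; apply: (is_derive_eq (pderivM (dPhi r (ltW r0))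
      (@pderivV _ (fun t => t ^+ n) r _ rn0 (pderivX n (is_derive_id r 1))))).
    case: n n0 n0' {cphi dPhi Gam GamE G0 rn0} => // n _ n0'; rewrite /= /id !exprS.
    by field; rewrite expf_neq0 gt_eqF.
exists Gam; split => // x.
have [x0|x0|->] := ltgtP x 0.
- apply: (@near_cst_continuous _ _ (gam 0 / n%:R)).
  by near=> y; rewrite /Gam ifT//; apply/ltW; near: y; exact: lt_nbhsl.
- exact: derivable_continuous (dG x x0).
apply/cvgrPdist_le => e e0.
have /cvgrPdist_le /(_ e e0) [d /= d0 dgam] := cg 0.
exists d => //= y; rewrite /ball_ /= sub0r normrN => yd.
rewrite G0; have [y0|y0] := leP y 0; first by rewrite /Gam y0 subrr normr0 ltW.
have yn0 : 0 < y ^+ n by rewrite exprn_gt0.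
(* Freezing [gam] at [gam 0] turns [Phi y] into [gam 0 / n%:R * y ^+ n]; the integrand changes by at
   most [t ^+ n.-1 * e]. *)
have : `|Phi y - gam 0 / n%:R * y ^+ n| <= e / n%:R * y ^+ n.
  apply: (@is_derive_norm_le _ (fun t => Phi t - gam 0 / n%:R * t ^+ n)
    (fun t => t ^+ n.-1 * (gam t - gam 0)) (fun t => e / n%:R * t ^+ n)
    (fun t => t ^+ n.-1 * e) 0); first exact: ltW.
  - move=> t t0; apply: pcontB.
      exact: derivable_continuous (dPhi t t0).
    by apply: pcontM; [exact: cst_continuous|exact: exprn_continuous].
  - move=> t _.
    by apply: pcontM; [exact: cst_continuous|exact: exprn_continuous].
  - move=> t /andP[t0 _].
    apply: (is_derive_eq (pderivB (dPhi t (ltW t0))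
      (pderivM (pderiv_cst _ t) (pderivX n (is_derive_id t 1))))).
    by rewrite /id; field; rewrite gt_eqF.
  - move=> t /andP[t0 _].
    apply: (is_derive_eq (pderivM (pderiv_cst _ t) (pderivX n (is_derive_id t 1)))).
    by rewrite /id; field; rewrite gt_eqF.
  - move=> t /andP[t0 ty]; rewrite normrM (ger0_norm (exprn_ge0 _ (ltW t0))).
    apply: ler_wpM2l; first by rewrite exprn_ge0// ltW.
    by rewrite distrC dgam//= sub0r normrN gtr0_norm// (lt_trans ty)// -(gtr0_norm y0).
  - by rewrite Phi0 expr0n eqn0Ngt n0 !mulr0 subrr normr0.
rewrite GamE// => H.
have -> : gam 0 / n%:R - Phi y / y ^+ n =
    - (Phi y - gam 0 / n%:R * y ^+ n) / y ^+ n by field; rewrite !gt_eqF.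
rewrite normrM normrN normrV ?unitfE ?gt_eqF// (gtr0_norm yn0) ler_pdivrMr//.
apply: (le_trans H); rewrite ler_pM2r// ler_pdivrMr// -[leLHS]mulr1 ler_pM2l//.
by rewrite ler1n.
Unshelve. all: by end_near. Qed.

End radial_average.

(** * Picard iteration *)

Section lorentz.
Context {R : realType}.
Implicit Types (s t x y : R).

Definition lorentz s := Num.sqrt (1 + s ^+ 2).

(* Inverse of [s |-> s / sqrt (1 - s ^+ 2)]: recovers the slope [u'] from the flux. *)
Definition slope s := s / lorentz s.

Lemma lorentz_sqr s : lorentz s ^+ 2 = 1 + s ^+ 2.
Proof. by rewrite sqr_sqrtr// addr_ge0// sqr_ge0. Qed.

Lemma lorentz_ge1 s : 1 <= lorentz s.
Proof. by rewrite -(sqrtr1 R) ler_wsqrtr// lerDl sqr_ge0. Qed.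

Lemma lorentz_gt0 s : 0 < lorentz s.
Proof. exact: lt_le_trans ltr01 (lorentz_ge1 s). Qed.

Lemma is_derive_lorentz s : is_derive s 1 lorentz (slope s).
Proof.
have s0 : 0 < 1 + s ^+ 2 by rewrite ltr_wpDr// sqr_ge0.
apply: (is_derive_eq (pderiv_comp (f := Num.sqrt)
  (pderivD (pderiv_cst 1 s) (pderivX 2 (is_derive_id s 1))) (is_derive1_sqrt s0))).
rewrite /slope /lorentz /id /=; field.
by rewrite gt_eqF// sqrtr_gt0.
Qed.

Lemma continuous_lorentz : continuous lorentz.
Proof. by move=> s; exact: derivable_continuous (is_derive_lorentz s). Qed.

Lemma is_derive_slope s : is_derive s 1 slope (lorentz s ^- 3).
Proof.
have q0 : lorentz s != 0 by rewrite gt_eqF// lorentz_gt0.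
apply: (is_derive_eq (pderivM (is_derive_id s 1) (pderivV q0 (is_derive_lorentz s)))).
rewrite /slope /id; transitivity ((lorentz s ^+ 2 - s ^+ 2) / lorentz s ^+ 3).
  by field.
by rewrite lorentz_sqr addrK div1r.
Qed.

Lemma continuous_slope : continuous slope.
Proof. by move=> s; exact: derivable_continuous (is_derive_slope s). Qed.

Lemma slope_sqr s : slope s ^+ 2 = 1 - lorentz s ^- 2.
Proof.
rewrite /slope expr_div_n.
have q0 : lorentz s ^+ 2 != 0 by rewrite expf_neq0// gt_eqF// lorentz_gt0.
have -> : s ^+ 2 = lorentz s ^+ 2 - 1 by rewrite lorentz_sqr addrC addKr.
by field; rewrite expf_eq0 in q0.
Qed.

Lemma slope_norm_lt1 s : `|slope s| < 1.
Proof.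
rewrite -(@expr_lt1 _ 2)// -normrX ger0_norm ?sqr_ge0// slope_sqr.
by rewrite ltrBlDr ltrDl invr_gt0 exprn_gt0// lorentz_gt0.
Qed.

(** The derivative [lorentz t ^- 3] lies between [0] and [1]. *)
Lemma slope_lipschitz x y : `|slope x - slope y| <= `|x - y|.
Proof.
wlog xy : x y / y <= x.
  by move=> H; have [/H//|/ltW/H] := leP y x; rewrite distrC (distrC y).
rewrite (ger0_norm (_ : 0 <= x - y)) ?subr_ge0//.
apply: (@is_derive_norm_le _ (fun t => slope t - slope y)
  (fun t => lorentz t ^- 3) (fun t => t - y) (fun=> 1) y x xy).
- move=> t _; apply: pcontB; [exact: continuous_slope|exact: pcont_cst].
- move=> t _; apply: (@pcontB _ _ id); [exact: cvg_id|exact: pcont_cst].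
- move=> t _; apply: (is_derive_eq (pderivB (is_derive_slope t) (pderiv_cst _ t))).
  by rewrite subr0.
- move=> t _; apply: (is_derive_eq (pderivB (is_derive_id t 1) (pderiv_cst _ t))).
  by rewrite subr0.
- move=> t _; rewrite ger0_norm ?invr_ge0 ?exprn_ge0 ?(ltW (lorentz_gt0 _))//.
  by rewrite invf_le1 ?exprn_gt0 ?lorentz_gt0// exprn_ege1// lorentz_ge1.
- by rewrite !subrr normr0.
Qed.

End lorentz.

Section geometric_limit.
Context {R : realType}.

(** The intervals of radius [2 * C / 2 ^+ n] around [x n] are nested, as the radius drops by exactly
    [C / 2 ^+ n] at each step; [l] is the supremum of their left ends. *)
Lemma geometric_limit (x : nat -> R) (C : R) :
  (forall n, `|x n.+1 - x n| <= C / 2 ^+ n) ->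
  exists l, forall n, `|l - x n| <= 2 * C / 2 ^+ n.
Proof.
move=> xC; pose c n := 2 * C / 2 ^+ n.
have cS n : c n - c n.+1 = C / 2 ^+ n.
  by rewrite /c exprS; field; rewrite expf_neq0// pnatr_eq0.
have a_nd : nondecreasing_seq (fun n => x n - c n).
  apply/nondecreasing_seqP => n; have := cS n; have := xC n.
  by rewrite ler_norml => /andP[]; lra.
have b_ni : nonincreasing_seq (fun n => x n + c n).
  apply/nonincreasing_seqP => n; have := cS n; have := xC n.
  by rewrite ler_norml => /andP[]; lra.
have c0 n : 0 <= c n.
  rewrite /c -mulrA mulr_ge0// ?divr_ge0// ?exprn_ge0//.
  by have := le_trans (normr_ge0 _) (xC 0%N); rewrite expr0 divr1.
have ab m n : x m - c m <= x n + c n.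
  apply: (le_trans (a_nd _ _ (leq_maxl m n))).
  apply: (le_trans _ (b_ni _ _ (leq_maxr m n))).
  by have := c0 (maxn m n); lra.
pose A := [set x n - c n | n in setT].
exists (sup A) => n; rewrite ler_norml; apply/andP; split.
  have : x n - c n <= sup A.
    apply: ub_le_sup; last by exists n.
    by exists (x 0%N + c 0%N) => _ [m _ <-].
  by rewrite -/(c n); lra.
have : sup A <= x n + c n.
  apply: ge_sup; first by exists (x 0%N - c 0%N); exists 0%N.
  by move=> _ [m _ <-].
by rewrite -/(c n); lra.
Qed.

End geometric_limit.

(** * One Picard step and its contraction estimate *)

Section picard.
Context {R : realType}.
Variables (n : nat) (g : R -> R) (L xi : R).
Hypotheses (n0 : (0 < n)%N) (L1 : 1 <= L).
Hypothesis gL : forall x y, `|g x - g y| <= L * `|x - y|.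
Implicit Types (u w : R -> R).

(** A relation rather than an operator: it determines [w] on [r >= 0], and for negative [r] asks
    only for continuity. *)
Definition picard u w := exists Gam,
  [/\ radial_average n (fun t => - g (u t)) Gam, continuous w, w 0 = xi &
      forall r : R, 0 < r -> is_derive r 1 w (slope (r * Gam r))].

Let cg : continuous g.
Proof.
move=> x; apply/cvgrPdist_le => e e0.
have L0 : 0 < L by exact: lt_le_trans ltr01 L1.
exists (e / L) => /=; first by rewrite divr_gt0.
move=> y; rewrite /ball_ /= ltr_pdivlMr// mulrC => /ltW; apply: le_trans.
exact: gL.
Qed.

Lemma picard_exists u : continuous u -> exists w, picard u w.
Proof.
move=> cu.
have cgu : continuous (fun t => - g (u t)).
  by move=> t; apply: pcontN; apply: (@pcont_comp _ _ g u t (cu t)); exact: cg.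
have [Gam GamP] := radial_average_exists n0 cgu.
have [cG _ _] := GamP.
have cV : continuous (fun r : R => slope (r * Gam r)).
  move=> t; apply: (@pcont_comp _ _ slope (fun r : R => r * Gam r)).
    by apply: (@pcontM _ _ id); [exact: cvg_id|exact: cG].
  exact: continuous_slope.
have [F [F0 dF]] := antiderivative cV.
(* [F] is controlled on [r >= 0] only; freezing it at [F 0] for negative [r] makes the result
   continuous everywhere. *)
exists (fun r => xi + F (Num.max r 0)), Gam; split => //.
- move=> t; apply: pcontD; first exact: pcont_cst.
  apply: (@pcont_comp _ _ F (fun r : R => Num.max r 0)).
    by apply: continuous_max; [exact: cvg_id|exact: cst_continuous].
  by apply: derivable_continuous; apply: dF; rewrite le_max lexx orbT.
- by rewrite maxxx F0 addr0.
move=> r r0; apply: (@near_eq_is_derive _ _ _ (fun r => xi + F r)).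
  near=> t; rewrite max_l//; apply: ltW; near: t; exact: lt_nbhsr.
apply: (is_derive_eq (pderivD (pderiv_cst xi r) (dF r (ltW r0)))).
by rewrite add0r.
Unshelve. all: by end_near. Qed.

Let is_derive_weight (K t : R) :
  is_derive t 1 (fun t => K / 2 * expR (L * t ^+ 2)) (t * (L * (K * expR (L * t ^+ 2)))).
Proof.
apply: (is_derive_eq (pderivM (pderiv_cst (K / 2) t) (pderiv_comp (f := expR)
  (pderivM (pderiv_cst L t) (pderivX 2 (is_derive_id t 1))) (is_derive_expR _)))).
by rewrite /id /=; field.
Qed.

(** The slopes at [t] differ by at most [t * (L * (K * expR (L * t ^+ 2)))], whose antiderivative is
    [K / 2 * expR (L * t ^+ 2)]. The factor [1 / 2] does not depend on [r], so the iteration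
    converges on the whole half-line and no continuation argument is needed. *)
Lemma picard_contraction u1 u2 w1 w2 K : picard u1 w1 -> picard u2 w2 ->
  (forall r, 0 <= r -> `|u1 r - u2 r| <= K * expR (L * r ^+ 2)) ->
  forall r, 0 <= r -> `|w1 r - w2 r| <= K / 2 * expR (L * r ^+ 2).
Proof.
move=> [G1 [a1 c1 i1 d1]] [G2 [a2 c2 i2 d2]] uK r r0.
have L0 : 0 < L by exact: lt_le_trans ltr01 L1.
have K0 : 0 <= K.
  have := le_trans (normr_ge0 _) (uK 0 (lexx _)).
  by rewrite pmulr_lge0// expR_gt0.
have GK t : 0 <= t -> `|G1 t - G2 t| <= L * (K * expR (L * t ^+ 2)).
  move=> t0; apply: (le_trans
    (radial_average_norm_le (M := L * (K * expR (L * t ^+ 2))) n0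
      (radial_averageB a1 a2) t0 _)).
    move=> s /andP[s0 st]; rewrite opprK addrC.
    apply: (le_trans (gL _ _)); rewrite ler_pM2l//.
    rewrite distrC; apply: (le_trans (uK s s0)); apply: ler_wpM2l => //.
    by rewrite ler_expR ler_pM2l// ler_pXn2r.
  rewrite ler_pdivrMr ?ltr0n// ler_peMr ?ler1n//.
  by rewrite !mulr_ge0// ?expR_ge0// ltW.
apply: (@is_derive_norm_le _ (fun t => w1 t - w2 t)
  (fun t => slope (t * G1 t) - slope (t * G2 t)) (fun t => K / 2 * expR (L * t ^+ 2))
  (fun t => t * (L * (K * expR (L * t ^+ 2)))) 0 r r0).
- by move=> t _; apply: pcontB; [exact: c1|exact: c2].
- by move=> t _; exact: derivable_continuous (is_derive_weight K t).
- by move=> t /andP[t0 _]; exact: pderivB (d1 t t0) (d2 t t0).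
- by move=> t _; exact: is_derive_weight.
- move=> t /andP[/ltW t0 _]; apply: (le_trans (slope_lipschitz _ _)).
  by rewrite -mulrBr normrM ger0_norm// ler_wpM2l// GK.
- by rewrite i1 i2 subrr normr0 mulr_ge0 ?expR_ge0// divr_ge0.
Qed.

End picard.

Section picard_fixpoint.
Context {R : realType}.

Lemma geometric_le (A e : R) : 0 < e -> exists k, A / 2 ^+ k <= e.
Proof.
move=> e0; exists (Num.truncn `|A / e|).+1.
set k := (Num.truncn _).+1; rewrite ler_pdivrMr ?exprn_gt0// mulrC -ler_pdivrMr//.
apply: (le_trans (ler_norm _)); apply: (@le_trans _ _ k%:R).
  by apply: ltW; exact: truncnS_gt.
by rewrite -natrX ler_nat ltnW// ltn_expl.
Qed.

Lemma picard_fixpoint n (g : R -> R) L xi : (0 < n)%N -> 1 <= L ->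
  (forall x y, `|g x - g y| <= L * `|x - y|) ->
  exists U, picard n g xi U U.
Proof.
move=> n0 L1 gL.
have L0 : 0 < L by exact: lt_le_trans ltr01 L1.
(* Iterating requires a total operator; for discontinuous [u] the condition on [T u] is vacuous. *)
have [T TP] : {T : (R -> R) -> R -> R & forall u, continuous u -> picard n g xi u (T u)}.
  apply: (@choice _ _ (fun u w : R -> R => continuous u -> picard n g xi u w)) => u.
  have [cu|ncu] := pselect (continuous u).
    by have [w uw] := picard_exists xi n0 L1 gL cu; exists w.
  by exists u.
pose u k := iter k T (fun=> xi).
have cu k : continuous (u k).
  case: k => [|k]; first exact: cst_continuous.
  elim: k => [|k ck].
    by have [G [_ cw _ _]] := TP (fun=> xi) (@cst_continuous _ _ xi).
  by have [G [_ cw _ _]] := TP _ ck.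
have uS k : picard n g xi (u k) (u k.+1) by exact: TP.
have du k (r : R) : 0 <= r -> `|u k.+1 r - u k r| <= expR (L * r ^+ 2) / 2 ^+ k.
  move=> r0; rewrite mulrC; elim: k r r0 => [|k IH] r r0; last first.
    have := @picard_contraction _ _ _ _ _ n0 L1 gL _ _ _ _ _ (uS k.+1) (uS k) IH r r0.
    by rewrite (exprS _ k) invfM (mulrC 2^-1).
  (* First increment: slopes stay below [1], so it is at most [r], and
     [r <= 1 + L * r ^+ 2 <= expR (L * r ^+ 2)]. *)
  rewrite expr0 invr1 mul1r; apply: (@le_trans _ _ r).
    have [G [_ cw w0 dw]] := uS 0%N.
    apply: (@is_derive_norm_le _ (fun t => u 1%N t - xi)
      (fun t => slope (t * G t)) id (fun=> 1) 0 r r0).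
    - by move=> t _; apply: pcontB; [exact: cw|exact: pcont_cst].
    - by move=> t _; exact: cvg_id.
    - move=> t /andP[t0 _].
      by apply: (is_derive_eq (pderivB (dw t t0) (pderiv_cst xi t))); rewrite subr0.
    - by move=> t _; exact/ltW/slope_norm_lt1.
    - by rewrite w0 subrr normr0.
  apply: (le_trans _ (expR_ge1Dx _)).
  have : r ^+ 2 <= L * r ^+ 2 by rewrite ler_peMl// sqr_ge0.
  by move: (sqr_ge0 (r - 1)); rewrite sqrrB1; lra.
have [U UP] : {U : R -> R & forall r k,
    `|U r - u k (Num.max r 0)| <= 2 * expR (L * (Num.max r 0) ^+ 2) / 2 ^+ k}.
  apply: (@choice _ _ (fun (r : R) (l : R) => forall k,
    `|l - u k (Num.max r 0)| <= 2 * expR (L * (Num.max r 0) ^+ 2) / 2 ^+ k)) => r.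
  apply: geometric_limit => k.
  by apply: du; rewrite le_max lexx orbT.
(* Convergence is uniform on bounded sets, so continuity passes to the limit by splitting [e] into
   three parts. *)
have cU : continuous U.
  move=> x; apply/cvgrPdist_le => e e0.
  have [k kP] := geometric_le (2 * expR (L * (`|x| + 1) ^+ 2)) (divr_gt0 e0 (ltr0n R 3)).
  have bd y : `|x - y| <= 1 -> `|U y - u k (Num.max y 0)| <= e / 3.
    move=> xy; apply: (le_trans (UP y k)); apply: le_trans kP.
    rewrite ler_pM2r ?invr_gt0 ?exprn_gt0// ler_pM2l// ler_expR ler_pM2l//.
    have y0 : 0 <= Num.max y 0 by rewrite le_max lexx orbT.
    have : Num.max y 0 <= `|x| + 1.
      rewrite ge_max addr_ge0// andbT; have := ler_norm x.
      by move: xy; rewrite ler_norml => /andP[]; lra.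
    by move=> H; rewrite ler_pXn2r// nnegrE addr_ge0.
  have cm : {for x, continuous (fun y : R => u k (Num.max y 0))}.
    apply: (@pcont_comp _ _ (u k) (fun r : R => Num.max r 0)); last exact: cu.
    by apply: continuous_max; [exact: cvg_id|exact: cst_continuous].
  near=> y.
  have H1 : `|U y - u k (Num.max y 0)| <= e / 3.
    by apply: bd; near: y; exists 1 => //= z; exact: ltW.
  have H2 : `|U x - u k (Num.max x 0)| <= e / 3 by apply: bd; rewrite subrr normr0.
  have H3 : `|u k (Num.max x 0) - u k (Num.max y 0)| <= e / 3.
    near: y; move/cvgrPdist_le : cm; apply; exact: divr_gt0.
  move: H1 H2 H3; rewrite !ler_norml => /andP[? ?] /andP[? ?] /andP[? ?].
  by apply/andP; split; lra.
(* [W], the image of [U], is also the limit of the iterates by contraction; hence it agrees with [U]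
   on [r >= 0]. *)
have [W UW] := picard_exists xi n0 L1 gL cU.
have WU r : 0 <= r -> U r = W r.
  move=> r0; apply/eqP; rewrite -subr_eq0 -normr_le0.
  apply/ler_addgt0Pl => e e0; rewrite addr0.
  have [k kP] := geometric_le (2 * expR (L * r ^+ 2)) e0.
  have Uk t j : 0 <= t -> `|U t - u j t| <= 2 / 2 ^+ j * expR (L * t ^+ 2).
    by move=> t0; have := UP t j; rewrite max_l// mulrAC.
  have := @picard_contraction _ _ _ _ _ n0 L1 gL _ _ _ _ _ UW (uS k)
    (fun t t0 => Uk t k t0) r r0.
  have := Uk r k.+1 r0.
  have -> : 2 / 2 ^+ k.+1 = 2 / 2 ^+ k / 2 :> R.
    by rewrite exprS; field; rewrite expf_neq0// pnatr_eq0.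
  move: kP; rewrite (mulrAC 2) (mulrAC (2 / 2 ^+ k)).
  set A := 2 / 2 ^+ k * _ => kP.
  rewrite !ler_norml => /andP[? ?] /andP[? ?].
  by apply/andP; split; lra.
exists U; have [G [aG cW W0 dW]] := UW.
exists G; split => //; first by rewrite WU.
move=> r r0; apply: (@near_eq_is_derive _ _ _ W); last exact: dW.
by near=> t; rewrite WU// ltW//; near: t; exact: lt_nbhsr.
Unshelve. all: by end_near. Qed.

End picard_fixpoint.

(** * Powers of the positive part and their truncation *)

Section pospow.
Context {R : realType}.

(* The positive part is needed because [powR] is [1] on negative reals. *)
Definition pospow (a x : R) := Num.max x 0 `^ a.

Lemma pospow_ge0 a x : 0 <= pospow a x.
Proof. exact: powR_ge0. Qed.

Lemma pospow_le0 a x : 0 < a -> x <= 0 -> pospow a x = 0.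
Proof. by move=> a0 x0; rewrite /pospow max_r// powR0// gt_eqF. Qed.

Lemma pospow_gt0 a x : 0 < x -> pospow a x = x `^ a.
Proof. by move=> x0; rewrite /pospow max_l// ltW. Qed.

Lemma ler_pospow a x y : 0 < a -> x <= y -> pospow a x <= pospow a y.
Proof.
move=> a0 xy; apply: ge0_ler_powR; [exact: ltW|..|].
- by rewrite nnegrE le_max lexx orbT.
- by rewrite nnegrE le_max lexx orbT.
- by rewrite ge_max !le_max xy lexx !orbT.
Qed.

Lemma pospowS (a x : R) : 0 < a -> pospow (a + 1) x = pospow a x * x.
Proof.
move=> a0; have [x0|x0] := leP x 0; first by rewrite !pospow_le0 ?mul0r// addr_gt0.
by rewrite !pospow_gt0// powRD ?powRr1 ?(ltW x0)// (gt_eqF x0) implybT.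
Qed.

(** At [0], the identity [pospow (a + 1) z = pospow a z * z] exhibits [pospow a] as the difference
    quotient, and it tends to [0] there for every [a > 0]. *)
Lemma is_derive_pospow (a x : R) : 0 < a ->
  is_derive x 1 (pospow (a + 1)) ((a + 1) * pospow a x).
Proof.
move=> a0; have a1 : 0 < a + 1 by rewrite addr_gt0.
have [x0|x0|->] := ltgtP x 0.
- rewrite pospow_le0 ?ltW// mulr0; apply: (@near_eq_is_derive _ _ _ (fun=> 0)).
  by near=> y; rewrite pospow_le0// ltW//; near: y; exact: lt_nbhsl.
- apply: (@near_eq_is_derive _ _ _ (fun y => y `^ (a + 1))).
    by near=> y; rewrite pospow_gt0//; near: y; exact: lt_nbhsr.
  by rewrite pospow_gt0// -[X in _ `^ X](addrK 1); exact: is_derive1_powR.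
rewrite pospow_le0// mulr0; apply/is_derive1_caratheodory.
exists (pospow a); split.
- by move=> z; rewrite subr0 pospowS// [X in _ - X]pospow_le0// subr0.
- apply/cvgrPdist_le => e e0; rewrite pospow_le0//.
  exists (e `^ a^-1) => /=; first exact: powR_gt0.
  move=> y; rewrite /ball_ /= sub0r sub0r !normrN => ye.
  rewrite ger0_norm ?pospow_ge0//.
  have -> : e = pospow a (e `^ a^-1).
    by rewrite pospow_gt0 ?powR_gt0// -powRrM mulVf ?gt_eqF// powRr1// ltW.
  by apply: ler_pospow => //; apply: le_trans (ler_norm _) (ltW ye).
- by rewrite pospow_le0.
Unshelve. all: by end_near. Qed.

(** Below [1] the derivative [p * pospow (p - 1) t] is at most [p]. Truncating at [1] thus makes the
    source globally Lipschitz, without affecting a nonincreasing profile of height at most [1]. *)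
Lemma pospow_lipschitz (p x y : R) : 1 < p ->
  `|pospow p (Num.min x 1) - pospow p (Num.min y 1)| <= p * `|x - y|.
Proof.
move=> p1; wlog xy : x y / y <= x.
  by move=> H; have [/H//|/ltW/H] := leP y x; rewrite distrC (distrC y).
have p0 : 0 < p - 1 by rewrite subr_gt0.
rewrite (ger0_norm (_ : 0 <= x - y)) ?subr_ge0//.
set a := Num.min x 1; set b := Num.min y 1.
have ab : b <= a by rewrite /a /b le_min !ge_min xy lexx orbT.
apply: (@le_trans _ _ (p * (a - b))); last first.
  rewrite ler_pM2l; last exact: lt_trans ltr01 p1.
  by rewrite /a /b; case: (leP x 1); case: (leP y 1) => ? ?; lra.
have d t := is_derive_pospow t p0.
apply: (@is_derive_norm_le _ (fun t => pospow p t - pospow p b)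
  (fun t => p * pospow (p - 1) t) (fun t => p * (t - b)) (fun=> p) b a ab).
- move=> t _; apply: pcontB; last exact: pcont_cst.
  by rewrite -[p](subrK 1); exact: derivable_continuous (d t).
- move=> t _; apply: pcontM; first exact: pcont_cst.
  by apply: (@pcontB _ _ id); [exact: cvg_id|exact: pcont_cst].
- move=> t _; have := d t; rewrite subrK => dt.
  by apply: (is_derive_eq (pderivB dt (pderiv_cst _ t))); rewrite subr0.
- move=> t _; apply: (is_derive_eq (pderivM (pderiv_cst p t)
    (pderivB (is_derive_id t 1) (pderiv_cst b t)))).
  by rewrite mul0r add0r subr0 mulr1.
- move=> t /andP[_ ta]; have pp : 0 < p by exact: lt_trans ltr01 p1.
  rewrite ger0_norm ?mulr_ge0 ?pospow_ge0 ?(ltW pp)// ler_piMr ?(ltW pp)//.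
  apply: (@le_trans _ _ (pospow (p - 1) 1)); last by rewrite pospow_gt0// powR1.
  apply: ler_pospow => //.
  by rewrite (le_trans (ltW ta))// /a ge_min lexx orbT.
- by rewrite !subrr normr0 mulr0.
Qed.

End pospow.

(** * The Pohozaev functional *)

Section pohozaev.
Context {R : realType}.
Variables (n : nat) (p xi c : R) (U G : R -> R).
Hypotheses (n3 : (3 <= n)%N) (p1 : 1 < p) (xi0 : 0 < xi) (xi1 : xi <= 1).
Hypothesis cE : c * (p + 1) = n%:R.
Hypothesis xi_small : n%:R * xi < 2 * (n%:R - 2 - 2 * c).
Let g (x : R) := pospow p (Num.min x 1).
Hypothesis avgG : radial_average n (fun t => - g (U t)) G.
Hypothesis cU : continuous U.
Hypothesis U0 : U 0 = xi.
Hypothesis dU : forall r : R, 0 < r -> is_derive r 1 U (slope (r * G r)).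

Let n0 : (0 < n)%N. Proof. exact: leq_trans n3. Qed.
Let nR0 : 0 < n%:R :> R. Proof. by rewrite ltr0n. Qed.
Let p0 : 0 < p. Proof. exact: lt_trans ltr01 p1. Qed.
Let pS0 : 0 < p + 1. Proof. by rewrite addr_gt0. Qed.
Let c0 : 0 < c. Proof. by rewrite -(pmulr_lgt0 _ pS0) cE. Qed.
Let cG : continuous G. Proof. by case: avgG. Qed.
Let dG (r : R) : 0 < r -> is_derive r 1 G ((- g (U r) - n%:R * G r) / r).
Proof. by case: avgG => _ _; exact. Qed.

Let G_le0 r : 0 <= r -> G r <= 0.
Proof.
move=> r0; rewrite -oppr_ge0 -(mul0r n%:R^-1).
apply: (radial_average_ge n0 (radial_averageN avgG) r0) => t _.
by rewrite opprK pospow_ge0.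
Qed.

Let slope_le0 (r : R) : 0 <= r -> slope (r * G r) <= 0.
Proof.
move=> r0; rewrite /slope ler_pdivrMr ?lorentz_gt0// mul0r.
by rewrite mulr_ge0_le0// G_le0.
Qed.

Lemma profile_nonincreasing (r s : R) : 0 <= r -> r <= s -> U s <= U r.
Proof.
move=> r0 rs; rewrite -lerN2.
apply: (@is_derive_nondecreasing _ (fun t => - U t) (fun t => - slope (t * G t)) r s rs).
- by move=> t _; apply: pcontN; exact: cU.
- move=> t /andP[rt _]; exact: is_deriveN (dU (le_lt_trans r0 rt)).
- move=> t /andP[rt _]; rewrite oppr_ge0; apply: slope_le0.
  exact: ltW (le_lt_trans r0 rt).
Qed.

Let U_le r : 0 <= r -> U r <= xi.
Proof. by move=> r0; rewrite -U0; exact: profile_nonincreasing. Qed.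

Let gU r : 0 <= r -> g (U r) = pospow p (U r).
Proof. by move=> r0; rewrite /g min_l// (le_trans (U_le r0)). Qed.

(** Up to a constant factor, the total flux through the sphere of radius [r]. *)
Let rnG (r : R) := r ^+ n * G r.

Let is_derive_rnG (r : R) : 0 < r ->
  is_derive r 1 rnG (- (r ^+ n.-1 * pospow p (U r))).
Proof.
move=> r0; apply: (is_derive_eq (pderivM (pderivX n (is_derive_id r 1)) (dG r0))).
rewrite -gU ?ltW// /id; case: (n) n0 => // m _ /=; rewrite exprS.
by field; rewrite gt_eqF.
Qed.

Let continuous_rnG : continuous rnG.
Proof.
move=> r; apply: (@pcontM _ _ (fun t : R => t ^+ n)); last exact: cG.
exact: exprn_continuous.
Qed.

(** Near [0] the sign comes from [G 0 < 0] and continuity; farther out it persists because [rnG] is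
    nonincreasing. *)
Let G_lt0 (r : R) : 0 < r -> G r < 0.
Proof.
move=> r0; have G00 : G 0 < 0.
  case: avgG => _ -> _; rewrite mulNr oppr_lt0 divr_gt0// gU// U0.
  by rewrite pospow_gt0// powR_gt0.
have /cvgrPdist_lt /(_ (- G 0)) := @cG 0.
rewrite oppr_gt0 => /(_ G00) [d /= d0 Gd].
have Gneg s : 0 < s -> s < d -> G s < 0.
  move=> s0 sd; have := Gd s; rewrite /ball_ /= sub0r normrN gtr0_norm// => /(_ sd).
  by rewrite ltr_norml => /andP[]; lra.
have [rd|dr] := ltP r d; first exact: Gneg.
have d20 : 0 < d / 2 by rewrite divr_gt0.
have d2d : d / 2 < d by lra.
have : rnG r <= rnG (d / 2).
  rewrite -lerN2; apply: (@is_derive_nondecreasing _ (fun t => - rnG t)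
    (fun t => t ^+ n.-1 * pospow p (U t))).
  - by lra.
  - by move=> t _; apply: pcontN; exact: continuous_rnG.
  - move=> t /andP[dt _]; rewrite -[X in is_derive _ _ _ X]opprK.
    exact: is_deriveN (is_derive_rnG (lt_trans d20 dt)).
  - move=> t /andP[dt _]; rewrite mulr_ge0 ?pospow_ge0// exprn_ge0//.
    exact: ltW (lt_trans d20 dt).
have : rnG (d / 2) < 0 by rewrite /rnG pmulr_rlt0 ?exprn_gt0// Gneg.
move=> /[swap] /le_lt_trans /[apply].
by rewrite /rnG pmulr_rlt0// exprn_gt0.
Qed.

Let F (x : R) := pospow (p + 1) x / (p + 1).
(** The flux variable [V], that is, [u' / sqrt (1 - u'^2)]. *)
Let rG (r : R) := r * G r.

Let continuous_rG : continuous rG.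
Proof. by move=> r; apply: (@pcontM _ _ id); [exact: cvg_id|exact: cG]. Qed.

Let is_derive_rG (r : R) : 0 < r ->
  is_derive r 1 rG (- pospow p (U r) - (n%:R - 1) * G r).
Proof.
move=> r0; apply: (is_derive_eq (pderivM (is_derive_id r 1) (dG r0))).
by rewrite /id gU ?ltW//; field; rewrite gt_eqF.
Qed.

Let is_derive_F (x : R) : is_derive x 1 F (pospow p x).
Proof.
apply: (is_derive_eq (pderivM (is_derive_pospow x p0) (pderiv_cst _ x))).
by field; rewrite gt_eqF.
Qed.

Let energy (r : R) := lorentz (rG r) - 1 + F (U r).

Let continuous_energy : continuous energy.
Proof.
move=> r; apply: (@pcontD _ _ (fun t => lorentz (rG t) - 1) (F \o U)).
  apply: pcontB; last exact: pcont_cst.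
  by apply: (@pcont_comp _ _ lorentz rG); [exact: continuous_rG|exact: continuous_lorentz].
apply: (@pcont_comp _ _ F U); first exact: cU.
exact: derivable_continuous (is_derive_F _).
Qed.

Let is_derive_energy (r : R) : 0 < r ->
  is_derive r 1 energy (- (n%:R - 1) * G r * slope (rG r)).
Proof.
move=> r0.
apply: (is_derive_eq (pderivD
  (pderivB (pderiv_comp (is_derive_rG r0) (is_derive_lorentz _)) (pderiv_cst 1 r))
  (pderiv_comp (dU r0) (is_derive_F _)))).
by rewrite /rG; ring.
Qed.

(** The energy does not increase, and its initial value is [F xi <= xi] because [xi <= 1]. *)
Let lorentz_rG_le (r : R) : 0 <= r -> lorentz (rG r) <= 1 + xi.
Proof.
move=> r0; have : energy r <= energy 0.
  rewrite -lerN2; apply: (@is_derive_nondecreasing _ (fun t => - energy t)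
    (fun t => - (- (n%:R - 1) * G t * slope (rG t))) 0 r r0).
  - by move=> t _; apply: pcontN; exact: continuous_energy.
  - by move=> t /andP[t0 _]; exact: is_deriveN (is_derive_energy t0).
  - move=> t /andP[/ltW t0 _]; rewrite !mulNr opprK -mulrA mulr_ge0//.
      by rewrite subr_ge0 ler1n.
    by apply: mulr_le0; [exact: G_le0|exact: slope_le0].
have FU : 0 <= F (U r) by rewrite /F divr_ge0 ?pospow_ge0// ltW.
have Fxi : F xi <= xi.
  rewrite /F ler_pdivrMr// pospow_gt0//.
  apply: (@le_trans _ _ xi); last by rewrite ler_pMr// lerDr ltW.
  by apply: ge1r_powR; rewrite ?xi0 ?xi1// lerDr ltW.
rewrite /energy U0 {2}/rG mul0r {2}/lorentz expr0n /= addr0 sqrtr1.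
by lra.
Qed.

(* With [c = n / (p + 1)] the terms in [U ^ (p + 1)] cancel in the derivative. *)
Let pohozaev (r : R) := r ^+ n * energy r + c * (U r * rnG r).

Let continuous_pohozaev : continuous pohozaev.
Proof.
move=> r; apply: (@pcontD _ _ (fun t : R => t ^+ n * energy t) (fun t : R => c * (U t * rnG t))).
  apply: (@pcontM _ _ (fun t : R => t ^+ n)); last exact: continuous_energy.
  exact: exprn_continuous.
apply: pcontM; first exact: pcont_cst.
by apply: pcontM; [exact: cU|exact: continuous_rnG].
Qed.

Let dpohozaev (r : R) := r ^+ n.-1 * (rG r ^+ 2 / lorentz (rG r)) *
  (n%:R * (lorentz (rG r) / (lorentz (rG r) + 1)) - (n%:R - 1) + c).

Let is_derive_pohozaev (r : R) : 0 < r -> is_derive r 1 pohozaev (dpohozaev r).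
Proof.
move=> r0.
apply: (is_derive_eq (pderivD
  (pderivM (pderivX n (is_derive_id r 1)) (is_derive_energy r0))
  (pderivM (pderiv_cst c r) (pderivM (dU r0) (is_derive_rnG r0))))).
have UF : pospow p (U r) * U r = (p + 1) * F (U r).
  by rewrite -pospowS// /F; field; rewrite gt_eqF.
rewrite /dpohozaev /energy /rnG -/(rG r) /slope /id.
have q0 := lorentz_gt0 (rG r); have q2 := lorentz_sqr (rG r).
have fE : rG r = r * G r by [].
move: q0 q2; set q := lorentz (rG r) => q0 q2.
have q10 : 0 < q + 1 by rewrite addr_gt0.
(* A consequence of [q ^+ 2 = 1 + rG r ^+ 2]; it turns the kinetic energy into a multiple of
   [rG r ^+ 2], like the other flux terms. *)
have HE : q - 1 = rG r ^+ 2 / (q + 1).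
  by apply: (mulIf (lt0r_neq0 q10)); rewrite divfK ?gt_eqF//; move: q2; nra.
have fG : rG r * (r ^+ n * G r) = r ^+ n.-1 * rG r ^+ 2.
  by rewrite fE; case: (n) n0 => // m _; rewrite /= exprS; ring.
(* The last bracket collects the potential terms and vanishes because [c * (p + 1) = n%:R]. *)
transitivity (n%:R * r ^+ n.-1 * (q - 1)
  + (c - (n%:R - 1)) / q * (rG r * (r ^+ n * G r))
  + r ^+ n.-1 * (n%:R * F (U r) - c * (pospow p (U r) * U r))).
  by field; rewrite gt_eqF.
rewrite UF (mulrA c) cE subrr mulr0 addr0 fG HE.
by field; rewrite !gt_eqF.
Qed.

Let dpohozaev_lt0 (r : R) : 0 < r -> dpohozaev r < 0.
Proof.
move=> r0; have q0 := lorentz_gt0 (rG r).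
have q1 := lorentz_ge1 (rG r); have qxi := lorentz_rG_le (ltW r0).
have rG0 : rG r < 0 by rewrite /rG pmulr_rlt0// G_lt0.
rewrite /dpohozaev pmulr_rlt0; last first.
  by rewrite mulr_gt0 ?exprn_gt0// divr_gt0// exprn_even_gt0//= lt_eqF.
move: q0 q1 qxi; set q := lorentz _ => q0 q1 qxi.
have q10 : 0 < q + 1 by rewrite addr_gt0.
(* Indeed [q / (q + 1) = 1 / 2 + (q - 1) / (2 * (q + 1))] with [1 <= q <= 1 + xi]. The hypothesis
   [xi_small] is what then makes the bracket in [dpohozaev] negative. *)
have : n%:R * (q / (q + 1)) <= n%:R / 2 + n%:R * xi / 4.
  have -> : n%:R / 2 + n%:R * xi / 4 = n%:R * (2^-1 + xi / 4) by field.
  rewrite ler_pM2l// ler_pdivrMr//.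
  by nra.
by move: xi_small; lra.
Qed.

Let pohozaev_lt0 (r : R) : 0 < r -> pohozaev r < 0.
Proof.
move=> r0; have -> : 0 = pohozaev 0.
  by rewrite /pohozaev /rnG expr0n eqn0Ngt n0 !mul0r !mulr0 addr0.
rewrite -ltrN2; apply: (@is_derive_increasing _ (fun t => - pohozaev t)
    (fun t => - dpohozaev t) 0 r r0).
- by move=> t _; apply: pcontN; exact: continuous_pohozaev.
- by move=> t /andP[t0 _]; exact: is_deriveN (is_derive_pohozaev t0).
- by move=> t /andP[t0 _]; rewrite oppr_gt0 dpohozaev_lt0.
Qed.

(** If [U r <= 0], then [pohozaev r >= 0]: the energy is nonnegative, thanks to the positive part in
    [F], and [U r * rnG r] is a product of two nonpositive factors. *)
Lemma profile_gt0 (r : R) : 0 <= r -> 0 < U r.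
Proof.
rewrite le_eqVlt => /predU1P[<-|r0]; first by rewrite U0.
have [Ur|//] := leP (U r) 0.
have := pohozaev_lt0 r0; rewrite ltNge => /negP[].
rewrite /pohozaev; apply: addr_ge0.
  apply: mulr_ge0; first by rewrite exprn_ge0// ltW.
  by rewrite /energy addr_ge0 ?subr_ge0 ?lorentz_ge1// /F divr_ge0 ?pospow_ge0// ltW.
apply: mulr_ge0; first exact: ltW.
apply: mulr_le0 => //.
by rewrite /rnG pmulr_rle0 ?exprn_gt0// ltW// G_lt0.
Qed.

Lemma profile_source (r : R) : 0 <= r -> g (U r) = U r `^ p.
Proof. by move=> r0; rewrite gU// pospow_gt0// profile_gt0. Qed.

(** If [U] stayed above [e], the flux [- rG r] would be at least [r e^p / n], whereas the energy
    keeps it bounded. *)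
Lemma profile_vanishes e : 0 < e -> exists M, forall r, M <= r -> U r < e.
Proof.
move=> e0; have ep0 : 0 < e `^ p by exact: powR_gt0.
(* With this [M] the flux would reach [2], against [1 + (rG M) ^+ 2 <= (1 + xi) ^+ 2 <= 4]. *)
pose M := 2 * n%:R / e `^ p; have M0 : 0 < M by rewrite /M divr_gt0// mulr_gt0.
exists M => r Mr; apply: (le_lt_trans (profile_nonincreasing (ltW M0) Mr)).
rewrite ltNge; apply/negP => eU.
have GM : e `^ p / n%:R <= - G M.
  apply: (radial_average_ge n0 (radial_averageN avgG) (ltW M0)) => t /andP[t0 tM].
  rewrite opprK gU// -pospow_gt0//; apply: ler_pospow => //.
  exact: le_trans eU (profile_nonincreasing t0 tM).
have : 2 <= - rG M.
  rewrite /rG -mulrN; apply: (@le_trans _ _ (M * (e `^ p / n%:R))); last first.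
    by rewrite ler_pM2l.
  rewrite /M le_eqVlt; apply/orP; left; apply/eqP; field.
  by rewrite !gt_eqF.
have := lorentz_rG_le (ltW M0); have := lorentz_sqr (rG M).
have := lorentz_gt0 (rG M); move: (rG M) (lorentz _) => f q q0 qE qxi f2.
by move: xi1; nra.
Qed.

(** Put [y = - rG r] and [m = r ^+ (n - 2)]. For [r >= 1], [pohozaev r <= - d] gives
    [d + m r^2 y^2 / 3 <= c U m r y]. Dropping [d] yields [r y <= 3 c U]; dropping the square
    instead and inserting this bound yields [d <= 3 c^2 U^2 m]. *)
Lemma profile_lower_bound :
  exists2 k, 0 < k & forall r, 1 <= r -> k <= U r ^+ 2 * r ^+ (n - 2).
Proof.
pose d := - pohozaev 1; have d0 : 0 < d by rewrite oppr_gt0 pohozaev_lt0.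
exists (d / (3 * c ^+ 2)); first by rewrite divr_gt0// mulr_gt0// exprn_gt0.
move=> r r1; have r0 : 0 < r by exact: lt_le_trans r1.
have Pr : pohozaev r <= - d.
  rewrite opprK -lerN2; apply: (@is_derive_nondecreasing _ (fun t => - pohozaev t)
    (fun t => - dpohozaev t) 1 r r1).
  - by move=> t _; apply: pcontN; exact: continuous_pohozaev.
  - by move=> t /andP[t1 _]; exact: is_deriveN (is_derive_pohozaev (lt_trans ltr01 t1)).
  - by move=> t /andP[t1 _]; rewrite oppr_ge0 ltW// dpohozaev_lt0// (lt_trans ltr01 t1).
rewrite ler_pdivrMr ?mulr_gt0 ?exprn_gt0//.
have Ur := profile_gt0 (ltW r0).
pose y := - rG r; have y0 : 0 < y by rewrite oppr_gt0 /rG pmulr_rlt0// G_lt0.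
have FU : 0 <= F (U r) by rewrite /F divr_ge0 ?pospow_ge0// ltW.
have q2 := lorentz_sqr (rG r); have q1 := lorentz_ge1 (rG r).
have qxi := lorentz_rG_le (ltW r0).
(* Here [q - 1 = y ^+ 2 / (q + 1)] and [q <= 1 + xi <= 2]. *)
have H : y ^+ 2 / 3 <= energy r.
  rewrite /energy; apply: (@le_trans _ _ (lorentz (rG r) - 1)); last by rewrite lerDl.
  rewrite ler_pdivrMr// /y sqrrN.
  by move: q2 q1 qxi xi1; set q := lorentz _; set f := rG r => ????; nra.
have rE : r ^+ n = r ^+ (n - 2) * r ^+ 2 by rewrite -exprD subnK// ltnW.
have m0 : 0 < r ^+ (n - 2) by rewrite exprn_gt0.
have yE : rnG r = - (r ^+ (n - 2) * r * y) by rewrite /rnG /y /rG rE; ring.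
move: Pr; rewrite /pohozaev yE rE; move: m0; set m := r ^+ (n - 2) => m0 Pr.
have A : d + m * r ^+ 2 * (y ^+ 2 / 3) <= c * U r * (m * r * y).
  have : m * r ^+ 2 * (y ^+ 2 / 3) <= m * r ^+ 2 * energy r.
    by rewrite ler_pM2l// mulr_gt0// exprn_gt0.
  by move: Pr; lra.
have B : r * y <= 3 * (c * U r).
  have mry : 0 < m * (r * y) by rewrite !mulr_gt0.
  rewrite -(ler_pM2l mry); move: A d0; nra.
apply: (@le_trans _ _ (c * U r * m * (r * y))).
  have : 0 <= m * r ^+ 2 * (y ^+ 2 / 3).
    by rewrite !mulr_ge0 ?exprn_ge0 ?invr_ge0 ?(ltW m0) ?(ltW r0) ?(ltW y0).
  by move: A; lra.
have -> : U r ^+ 2 * m * (3 * c ^+ 2) = c * U r * m * (3 * (c * U r)) by ring.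
by rewrite ler_pM2l// !mulr_gt0.
Qed.

End pohozaev.

(** * Radial functions on R^N *)

Section radial_functions.
Context {R : realType} {N : nat}.
Implicit Types (x y : 'rV[R]_N) (i j : 'I_N).

Lemma coordinate_continuous i : continuous (fun x => x 0 i).
Proof. exact: coord_continuous. Qed.

Let sqnorm x := \sum_(i < N) x 0 i ^+ 2.

Let sqnorm_ge0 x : 0 <= sqnorm x.
Proof. by apply: sumr_ge0 => i _; exact: sqr_ge0. Qed.

Lemma enorm_ge0 x : 0 <= enorm x.
Proof. exact: sqrtr_ge0. Qed.

Lemma enorm_sqr x : enorm x ^+ 2 = \sum_(i < N) x 0 i ^+ 2.
Proof. exact: (sqr_sqrtr (sqnorm_ge0 x)). Qed.

Lemma enorm0 : enorm (0 : 'rV[R]_N) = 0.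
Proof.
by rewrite /enorm big1 ?sqrtr0// => i _; rewrite mxE expr0n.
Qed.

Lemma coordinate_le_enorm x i : `|x 0 i| <= enorm x.
Proof.
rewrite -sqrtr_sqr ler_wsqrtr// (bigD1 i)//= lerDl.
by apply: sumr_ge0 => j _; exact: sqr_ge0.
Qed.

Lemma enorm_gt0 x : x != 0 -> 0 < enorm x.
Proof.
move=> x0; rewrite lt_def enorm_ge0 andbT; apply: contra x0 => /eqP xE.
apply/eqP/rowP => i; apply/eqP; rewrite mxE -normr_le0 -xE.
exact: coordinate_le_enorm.
Qed.

Lemma continuous_enorm : continuous (@enorm R N).
Proof.
move=> x; apply: (@pcont_comp _ _ Num.sqrt sqnorm); last exact: sqrt_continuous.
have -> : sqnorm = \sum_(i < N) (fun y => y 0 i ^+ 2).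
  by apply/funext => y; rewrite fct_sumE.
elim/big_ind : _ => [|f g cf cg|i _].
- exact: cst_continuous.
- exact: pcontD.
- by apply: pcontX; exact: coordinate_continuous.
Qed.

Lemma is_derive_line (u : 'rV[R]_N -> R) x (v : 'rV[R]_N) l :
  is_derive (0 : R) 1 (fun t : R => u (t *: v + x)) l -> is_derive x v u l.
Proof.
have E : (fun h : R => h^-1 *: ((u \o shift x) (h *: v) - u x)) =
    (fun h : R => h^-1 *: (((fun t : R => u (t *: v + x)) \o shift 0) (h *: 1) -
      (fun t : R => u (t *: v + x)) 0)).
  apply/funext => h /=; congr (_ *: (u _ - u _)).
    by rewrite /GRing.scale /= mulr1 addr0.
  by rewrite scale0r add0r.
move=> [+ +]; rewrite /derivable /derive -E => d1 d2.
by apply: DeriveDef.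
Qed.

Lemma sqnorm_line x i (t : R) :
  \sum_(j < N) (t *: delta_mx 0 i + x) 0 j ^+ 2 =
  enorm x ^+ 2 + (2 * x 0 i * t + t ^+ 2).
Proof.
rewrite enorm_sqr (bigD1 i)//= [in RHS](bigD1 i)//= !mxE !eqxx mulr1.
rewrite (eq_bigr (fun j => x 0 j ^+ 2)); first by ring.
by move=> j /negPf ji; rewrite !mxE ji andbF mulr0 add0r.
Qed.

Lemma is_derive_enorm_line x i : x != 0 ->
  is_derive (0 : R) 1 (fun t : R => enorm (t *: delta_mx 0 i + x)) (x 0 i / enorm x).
Proof.
move=> x0; have r0 := enorm_gt0 x0.
have -> : (fun t : R => enorm (t *: delta_mx 0 i + x)) =
    (fun t : R => Num.sqrt (enorm x ^+ 2 + (2 * x 0 i * t + t ^+ 2))).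
  by apply/funext => t; rewrite /enorm sqnorm_line.
have s0 : 0 < enorm x ^+ 2 + (2 * x 0 i * 0 + 0 ^+ 2).
  by rewrite mulr0 expr0n /= !addr0 exprn_gt0.
apply: (is_derive_eq (pderiv_comp (f := Num.sqrt)
  (pderivD (pderiv_cst (enorm x ^+ 2) 0) (pderivD
    (pderivM (pderiv_cst (2 * x 0 i) 0) (is_derive_id (0 : R) 1))
    (pderivX 2 (is_derive_id (0 : R) 1)))) (is_derive1_sqrt s0))).
rewrite mulr0 expr0n /= !addr0 sqrtr_sqr ger0_norm ?enorm_ge0// /id.
by field; rewrite gt_eqF.
Qed.

Lemma enorm_line0 i (t : R) : enorm (t *: delta_mx 0 i + 0 : 'rV[R]_N) = `|t|.
Proof.
by rewrite /enorm sqnorm_line enorm0 mxE mulr0 mul0r expr0n /= !add0r sqrtr_sqr.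
Qed.

(** With [U'] written as [r * h r], the gradient [h (enorm x) *: x] makes sense at the origin too,
    where [enorm] is not differentiable; there [U t - U 0] is of order [t ^+ 2]. *)
Lemma is_derive_radial (U h : R -> R) x i : continuous U -> continuous h ->
  (forall r : R, 0 < r -> is_derive r 1 U (r * h r)) ->
  is_derive x (delta_mx 0 i) (U \o @enorm R N) (h (enorm x) * x 0 i).
Proof.
move=> cU ch dU; apply: is_derive_line => /=.
have [->|x0] := eqVneq x 0; last first.
  have r0 := enorm_gt0 x0.
  have dU' : is_derive (enorm (0 *: delta_mx 0 i + x)) 1 U (enorm x * h (enorm x)).
    by rewrite scale0r add0r; exact: dU.
  apply: (is_derive_eq (pderiv_comp (is_derive_enorm_line i x0) dU')).
  by field; rewrite gt_eqF.
rewrite mxE mulr0; under eq_fun do rewrite enorm_line0.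
apply/is_derive1_caratheodory.
(* At [t = 0] the convention [0^-1 = 0] gives this quotient the value [0], which is the derivative
   sought. *)
exists (fun t => (U `|t| - U 0) / t); split.
- move=> t; rewrite normr0 subr0; have [->|t0] := eqVneq t 0.
    by rewrite normr0 subrr mulr0.
  by rewrite divfK.
- have /cvgrPdist_le /(_ 1 ltr01) [d /= d0 hd] := ch 0.
  have M0 : 0 < `|h 0| + 1 by rewrite ltr_wpDl.
  have Ub (t : R) : 0 <= t -> t < d -> `|U t - U 0| <= (`|h 0| + 1) * t ^+ 2.
    move=> t0 td; apply: (@is_derive_norm_le _ (fun t => U t - U 0)
      (fun t => t * h t) (fun t => (`|h 0| + 1) * t ^+ 2)
      (fun t => (`|h 0| + 1) * (2 * t)) 0 t t0).
    + by move=> s _; apply: pcontB; [exact: cU|exact: pcont_cst].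
    + move=> s _; apply: pcontM; first exact: pcont_cst.
      exact: exprn_continuous.
    + move=> s /andP[s0 _].
      by apply: (is_derive_eq (pderivB (dU s s0) (pderiv_cst _ s))); rewrite subr0.
    + move=> s _; apply: (is_derive_eq (pderivM (pderiv_cst (`|h 0| + 1) s)
        (pderivX 2 (is_derive_id s 1)))).
      by rewrite /id /=; ring.
    + move=> s /andP[s0 st]; rewrite normrM gtr0_norm// mulrCA.
      have : `|h s| <= `|h 0| + 1.
        have := hd s; rewrite /ball_ /= sub0r normrN gtr0_norm// => /(_ (lt_trans st td)).
        rewrite !ler_norml => /andP[? ?]; have := ler_norm (h 0).
        by have := ler_norm (- h 0); rewrite normrN => ? ?; apply/andP; split; lra.
      by move: M0; nra.
    + by rewrite subrr normr0 expr0n mulr0.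
  apply/cvgrPdist_le => e e0; rewrite invr0 mulr0.
  exists (Num.min d (e / (`|h 0| + 1))) => /=; first by rewrite lt_min d0 divr_gt0.
  move=> t; rewrite /ball_ /= !sub0r !normrN lt_min => /andP[td te].
  have [->|t0] := eqVneq t 0; first by rewrite invr0 mulr0 normr0 ltW.
  rewrite normrM normfV ler_pdivrMr ?normr_gt0//.
  apply: (le_trans (Ub _ (normr_ge0 t) td)).
  rewrite expr2 mulrA ler_pM2r ?normr_gt0// mulrC -ler_pdivlMr//.
  exact: ltW.
- by rewrite invr0 mulr0.
Qed.

(** Here [b] stands for [r * a']. At the origin the difference quotient along the line is [a] at
    [|t|] times [(i == j)%:R], so continuity of [a] suffices. *)
Lemma is_derive_radial_field (a b : R -> R) x i j : continuous a ->
  (forall r : R, 0 < r -> is_derive r 1 a (b r / r)) ->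
  is_derive x (delta_mx 0 j) (fun y => a (enorm y) * y 0 i)
    (a (enorm x) * (i == j)%:R + x 0 i * x 0 j * (b (enorm x) / enorm x ^+ 2)).
Proof.
move=> ca da; apply: is_derive_line.
have lineE t : (t *: delta_mx 0 j + x) 0 i = t * (i == j)%:R + x 0 i.
  by rewrite !mxE eqxx.
have [x0|x0] := eqVneq x 0; last first.
  have r0 := enorm_gt0 x0.
  have da' : is_derive (enorm (0 *: delta_mx 0 j + x)) 1 a (b (enorm x) / enorm x).
    by rewrite scale0r add0r; exact: da.
  under eq_fun do rewrite lineE.
  apply: (is_derive_eq (pderivM (pderiv_comp (is_derive_enorm_line j x0) da')
    (pderivD (pderivM (is_derive_id (0 : R) 1) (pderiv_cst (i == j)%:R (0 : R)))
      (pderiv_cst (x 0 i) (0 : R))))).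
  rewrite /id scale0r add0r; field.
  by rewrite gt_eqF.
have -> : (fun t : R => a (enorm (t *: delta_mx 0 j + x)) * (t *: delta_mx 0 j + x) 0 i) =
    (fun t => a `|t| * (t * (i == j)%:R)).
  by apply/funext => t; rewrite lineE x0 enorm_line0 mxE addr0.
rewrite x0 mxE !mul0r addr0 enorm0.
apply/is_derive1_caratheodory.
exists (fun t => a `|t| * (i == j)%:R); split.
- by move=> t; rewrite normr0 mul0r mulr0 !subr0 mulrA mulrAC.
- apply: pcontM; last exact: pcont_cst.
  apply: (@pcont_comp _ _ a Num.norm); last exact: ca.
  exact: norm_continuous.
- by rewrite normr0.
Qed.

Lemma continuous_radial_field (a : R -> R) i : continuous a ->
  continuous (fun y => a (enorm y) * y 0 i).
Proof.
move=> ca x; apply: (@pcontM _ _ (a \o @enorm R N)); last exact: coordinate_continuous.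
by apply: (@pcont_comp _ _ a (@enorm R N)); [exact: continuous_enorm|exact: ca].
Qed.

(** At the origin, [|x_i x_j| <= |x|^2] bounds the singular term by the absolute value of
    [b (enorm x)], which tends to [b 0 = 0]. *)
Lemma continuous_radial_hessian (a b : R -> R) i j : continuous a -> continuous b ->
  b 0 = 0 ->
  continuous (fun x => a (enorm x) * (i == j)%:R + x 0 i * x 0 j * (b (enorm x) / enorm x ^+ 2)).
Proof.
move=> ca cb b0 x.
have cae : {for x, continuous (fun y => a (enorm y))}.
  by apply: (@pcont_comp _ _ a (@enorm R N)); [exact: continuous_enorm|exact: ca].
have cbe : {for x, continuous (fun y => b (enorm y))}.
  by apply: (@pcont_comp _ _ b (@enorm R N)); [exact: continuous_enorm|exact: cb].
apply: (@pcontD _ _ (fun x => a (enorm x) * (i == j)%:R)).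
  by apply: pcontM => //; exact: pcont_cst.
have [x0|x0] := eqVneq x 0; last first.
  apply: pcontM; first by apply: pcontM; exact: coordinate_continuous.
  apply: pcontM; first exact: cbe.
  apply: pcontV; first by rewrite expf_neq0// gt_eqF// enorm_gt0.
  by apply: pcontX; exact: continuous_enorm.
apply/(@cvgrPdist_le _ _ _ (nbhs x) (nbhs_filter x)) => e e0.
near=> y.
have : `|b (enorm x) - b (enorm y)| <= e.
  by near: y; exact: (@cvgr_dist_le _ _ _ _ _ _ _ cbe).
rewrite x0 enorm0 b0 mxE !mul0r !sub0r !normrN => be.
have [->|y0] := eqVneq y 0; first by rewrite enorm0 b0 !mul0r mulr0 normr0 ltW.
have r0 := enorm_gt0 y0; apply: le_trans be.
rewrite !normrM normfV normrX (ger0_norm (enorm_ge0 y)) mulrCA.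
rewrite ler_piMr// ler_pdivrMr ?exprn_gt0// mul1r expr2.
by apply: ler_pM => //; exact: coordinate_le_enorm.
Unshelve. all: by end_near. Qed.

End radial_functions.

(** * From a radial profile to a classical solution *)

Section radial_solution.
Context {R : realType}.
Variables (N : nat) (p : R) (s U G : R -> R).
Hypotheses (N0 : (0 < N)%N) (cs : continuous s) (cU : continuous U).
Hypothesis avgG : radial_average N (fun t => - s t) G.
Hypothesis dU : forall r : R, 0 < r -> is_derive r 1 U (slope (r * G r)).

Let NR0 : 0 < N%:R :> R. Proof. by rewrite ltr0n. Qed.
Let cG : continuous G. Proof. by case: avgG. Qed.
Let u : 'rV[R]_N -> R := U \o @enorm R N.
(** [h] is [U' / r], while [bG] and [bh] below are [r * G'] and [r * h']; these are continuous and
    vanish at [0], as the Hessian formula requires. *)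
Let h (r : R) := G r / lorentz (r * G r).
Let bG (r : R) := - s r - N%:R * G r.
Let bh (r : R) := bG r / lorentz (r * G r) -
  r * G r * slope (r * G r) * (G r + bG r) / lorentz (r * G r) ^+ 2.

Let cV : continuous (fun r : R => r * G r).
Proof. by move=> r; apply: (@pcontM _ _ id); [exact: cvg_id|exact: cG]. Qed.

Let cq : continuous (fun r : R => lorentz (r * G r)).
Proof.
by move=> r; apply: (@pcont_comp _ _ lorentz (fun r : R => r * G r));
  [exact: cV|exact: continuous_lorentz].
Qed.

Let q0 r : lorentz (r * G r) != 0.
Proof. by rewrite gt_eqF// lorentz_gt0. Qed.

Let ch : continuous h.
Proof.
move=> r; apply: (@pcontM _ _ G (fun r : R => (lorentz (r * G r))^-1)); first exact: cG.
by apply: pcontV => //; exact: cq.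
Qed.

Let cbG : continuous bG.
Proof.
move=> r; apply: (@pcontB _ _ (fun t => - s t) (fun t => N%:R * G t)).
  by apply: pcontN; exact: cs.
by apply: pcontM; [exact: pcont_cst|exact: cG].
Qed.

Let cbh : continuous bh.
Proof.
move=> r; apply: (@pcontB _ _ (fun r : R => bG r / lorentz (r * G r))
  (fun r : R => r * G r * slope (r * G r) * (G r + bG r) / lorentz (r * G r) ^+ 2)).
  by apply: pcontM; [exact: cbG|apply: pcontV => //; exact: cq].
apply: pcontM; last first.
  by apply: pcontV; [rewrite expf_neq0|apply: pcontX; exact: cq].
apply: pcontM; last by apply: pcontD; [exact: cG|exact: cbG].
apply: pcontM; first exact: cV.
by apply: (@pcont_comp _ _ slope (fun r : R => r * G r)); [exact: cV|exact: continuous_slope].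
Qed.

Let bG0 : bG 0 = 0.
Proof. by rewrite /bG; case: avgG => _ -> _; field; rewrite gt_eqF. Qed.

Let bh0 : bh 0 = 0.
Proof. by rewrite /bh bG0 !mul0r subrr. Qed.

Let dG (r : R) : 0 < r -> is_derive r 1 G (bG r / r).
Proof. by case: avgG => _ _; exact. Qed.

Let dh (r : R) : 0 < r -> is_derive r 1 h (bh r / r).
Proof.
move=> r0.
have dV := pderivM (is_derive_id r 1) (dG r0).
have dq := pderiv_comp dV (is_derive_lorentz _).
apply: (is_derive_eq (pderivM (dG r0) (@pderivV _ (fun r : R => lorentz (r * G r)) r _ (q0 r) dq))).
have := q0 r; rewrite /bh /id; set q := lorentz _ => qn0.
by field; rewrite gt_eqF.
Qed.

Let dUh (r : R) : 0 < r -> is_derive r 1 U (r * h r).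
Proof. by rewrite /h mulrA; exact: dU. Qed.

Let is_derive_u x i : is_derive x (delta_mx 0 i) u (h (enorm x) * x 0 i).
Proof. exact: is_derive_radial. Qed.

Let partial_u i : partial i u = (fun x => h (enorm x) * x 0 i).
Proof. by apply/funext => x; case: (is_derive_u x i). Qed.

Lemma radial_Ck2 : Ck 2 u.
Proof.
split.
  by move=> x; apply: (@pcont_comp _ _ U (@enorm R N)); [exact: continuous_enorm|exact: cU].
move=> i; split; first by move=> x; case: (is_derive_u x i).
rewrite partial_u; split; first exact: continuous_radial_field.
move=> j; have dj x := is_derive_radial_field x i j ch dh.
split; first by move=> x; case: (dj x).
split => //; have -> : partial j (fun x => h (enorm x) * x 0 i) =
    (fun x => h (enorm x) * (i == j)%:R + x 0 i * x 0 j * (bh (enorm x) / enorm x ^+ 2)).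
  by apply/funext => x; case: (dj x).
exact: continuous_radial_hessian.
Qed.

Let enorm_grad_sqr x : enorm (grad u x) ^+ 2 = slope (enorm x * G (enorm x)) ^+ 2.
Proof.
rewrite enorm_sqr; under eq_bigr do rewrite mxE partial_u exprMn.
by rewrite -mulr_sumr -enorm_sqr -exprMn /slope /h; congr (_ ^+ 2); ring.
Qed.

Lemma radial_grad_lt1 x : enorm (grad u x) < 1.
Proof.
rewrite -(@expr_lt1 _ 2) ?enorm_ge0// enorm_grad_sqr.
rewrite -[X in X < _]ger0_norm ?sqr_ge0// normrX expr_lt1//.
exact: slope_norm_lt1.
Qed.

(** By [slope_sqr], [sqrt (1 - |grad u|^2)] is the inverse of the Lorentz factor, which cancels the
    one in [h]. *)
Let flux_u i : (fun x => flux u x 0 i) = (fun x => G (enorm x) * x 0 i).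
Proof.
apply/funext => x; rewrite !mxE partial_u enorm_grad_sqr slope_sqr.
rewrite /h; have := lorentz_gt0 (enorm x * G (enorm x)).
set q := lorentz _ => qgt0.
rewrite opprB addrC subrK sqrtrV ?exprn_ge0 ?ltW// sqrtr_sqr gtr0_norm// invrK.
by field; rewrite gt_eqF.
Qed.

(** The divergence of [G (enorm x) *: x] is [N G + r G'], which equals [- s] by the radial average
    equation; at the origin only [N G] remains. *)
Lemma radial_div_flux x : div (flux u) x = - s (enorm x).
Proof.
rewrite /div; under eq_bigr => i _.
  rewrite flux_u /partial.
  have [_ ->] := is_derive_radial_field x i i cG dG.
  rewrite eqxx mulr1 -expr2; over.
rewrite big_split /= sumr_const card_ord -mulr_suml -enorm_sqr.
have [->|x0] := eqVneq x 0.
  rewrite enorm0 bG0 mul0r mulr0 addr0; case: avgG => _ -> _; rewrite -mulr_natr.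
  by field; rewrite gt_eqF.
rewrite mulrC divfK ?expf_neq0 ?gt_eqF ?enorm_gt0// /bG -mulr_natl.
by ring.
Qed.

Hypothesis U_gt0 : forall r, 0 <= r -> 0 < U r.
Hypothesis sE : forall r, 0 <= r -> s r = U r `^ p.
Hypothesis U_vanishes : forall e, 0 < e -> exists M, forall r, M <= r -> U r < e.

Lemma radial_classical_solution : classical_solution p u.
Proof.
split.
- exact: radial_Ck2.
- exact: radial_grad_lt1.
- by move=> x; rewrite radial_div_flux sE ?enorm_ge0// addNr.
- by move=> x; apply: U_gt0; exact: enorm_ge0.
- move=> e /U_vanishes[M UM]; exists M => x /ltW Mx.
  by rewrite gtr0_norm ?UM// U_gt0// enorm_ge0.
Qed.

End radial_solution.

(** * Failure of membership in D^(1,2) *)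

Section integral_lower_bound.
Context d (T : measurableType d) {R : realType} (mu : {measure set T -> \bar R}).
Import HBNNSimple.
Local Open Scope ereal_scope.

Lemma integral_ge_on (f : T -> \bar R) (A : set T) (c : R) :
  measurable A -> (0 <= c)%R -> (forall x, 0 <= f x) ->
  (forall x, A x -> c%:E <= f x) -> c%:E * mu A <= \int[mu]_x f x.
Proof.
move=> mA c0 f0 cf; rewrite ge0_integralTE//.
(* The integral is the supremum over the simple functions below [f]. *)
apply: ereal_sup_ubound.
exists (scale_nnsfun (indic_nnsfun R mA) c0) => /=.
  move=> x; rewrite measurable_realfun.mindicE.
  have [xA|xA] := boolP (x \in A); last by rewrite /= mulr0.
  by rewrite /= mulr1; apply: cf; rewrite inE in xA.
transitivity (c%:E * sintegral mu (indic_nnsfun R mA)); last first.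
  by congr (_ * _); exact: sintegral_indic.
exact: sintegralrM.
Qed.

End integral_lower_bound.

(** * Lebesgue measure of cubes *)

Section boxes.
Context {R : realType}.
Local Notation T := (measurableTypeR R).

Definition box (n : nat) (a b : R) : set (n.-tuple T) :=
  [set t | forall i, a <= tnth t i <= b].

Lemma measurable_box n a b : measurable (@box n a b).
Proof.
have -> : @box n a b = \big[setI/setT]_(i < n) ((@tnth _ T ^~ i) @^-1` `[a, b]).
  apply/seteqP; split => t; rewrite -bigcap_seq /=.
    by move=> tab i _ /=; rewrite in_itv /=; exact: tab.
  by move=> tab i; have := tab i; rewrite /= in_itv /=; apply; rewrite mem_index_enum.
apply: bigsetI_measurable => i _; rewrite -[X in measurable X]setTI.
by apply: measurable_tnth => //; exact: measurable_itv.
Qed.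

Lemma lebesgueN_box n a b : a <= b ->
  lebesgueN R n (@box n a b) = ((b - a) ^+ n)%:E.
Proof.
move=> ab; elim: n => [|n IH] /=.
  by rewrite expr0 diracE mem_set// => -[].
rewrite /lebesgue_step /pushforward.
have -> : @tcons R n @^-1` @box n.+1 a b = `[a, b] `*` @box n a b.
  apply/seteqP; split => -[x t] /=.
    move=> H; split; first by have := H ord0; rewrite in_itv.
    by move=> i; have := H (lift ord0 i); rewrite tnthS.
  rewrite in_itv => -[xab tab] i; have [j ->|->] := unliftP ord0 i; last exact: xab.
  by rewrite tnthS.
rewrite product_measure1E//; last exact: measurable_box.
rewrite IH exprS EFinM; congr (_ * _)%E.
transitivity (lebesgue_measure (`[a, b] : set R)); first by [].
rewrite lebesgue_measure_itv /= lte_fin.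
by case: ltgtP ab => // -> _; rewrite subrr.
Qed.

End boxes.

Section test_functions.
Context {R : realType} {N : nat}.

(** A compact support is bounded in the sup norm, so a single large coordinate is enough to leave
    it; [0 < N] supplies one. *)
Lemma test_function_vanishes (phi : 'rV[R]_N -> R) : (0 < N)%N -> test_function phi ->
  exists M, forall (x : 'rV[R]_N), (forall i, M <= x 0 i) -> phi x = 0.
Proof.
move=> N0 [_ /compact_bounded[M [_ Mphi]]].
exists (M + 2) => x xM; apply/eqP; apply: contraT => phix.
have cx : closure [set y | phi y != 0] x by exact: subset_closure.
have := Mphi (M + 1); rewrite ltrDl => /(_ ltr01 x cx) /=.
have : x 0 (Ordinal N0) <= `|x|.
  rewrite /Num.Def.normr /= mx_normrE.
  apply: (le_trans (ler_norm _)).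
  exact: (le_bigmax _ (fun ij => `|x ij.1 ij.2|) (0, Ordinal N0)).
by have := xM (Ordinal N0); lra.
Qed.

End test_functions.

Section slow_decay.
Context {R : realType} {N : nat}.

(** Only the cube is kept in the integral; its volume is [(b - a) ^+ N]. *)
Lemma LpN_ge (q c a b : R) (f : 'rV[R]_N -> R) : 0 < q -> a <= b -> 0 <= c ->
  (forall x : 'rV[R]_N, (forall i, a <= x 0 i <= b) -> c <= `|f x|) ->
  (((c `^ q * (b - a) ^+ N) `^ q^-1)%:E <= LpN q f)%E.
Proof.
move=> q0 ab c0 cf; rewrite /LpN unlock -poweR_EFin.
apply: gt0_ler_poweR; first by rewrite invr_ge0 ltW.
- by rewrite in_itv /= leey lee_fin mulr_ge0 ?powR_ge0// exprn_ge0// subr_ge0.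
- by rewrite in_itv /= leey andbT integral_ge0// => x _; rewrite poweR_ge0.
rewrite EFinM -lebesgueN_box//; apply: integral_ge_on.
- exact: measurable_box.
- exact: powR_ge0.
- by move=> x; rewrite poweR_ge0.
- move=> t tab; rewrite -[leRHS]/((`|on_tuples f t|)%:E `^ q)%E poweR_EFin lee_fin.
  apply: ge0_ler_powR; rewrite ?nnegrE ?(ltW q0)//.
  by apply: cf => i; rewrite mxE; exact: tab.
Qed.

Lemma enorm_le_box (x : 'rV[R]_N) (b : R) : 0 <= b -> (forall i, 0 <= x 0 i <= b) ->
  enorm x <= Num.sqrt N%:R * b.
Proof.
move=> b0 xb; rewrite -[X in _ * X]ger0_norm// -sqrtr_sqr -sqrtrM// ler_wsqrtr//.
rewrite mulr_natl -[X in _ *+ X]card_ord -sumr_const; apply: ler_sum => i _.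
by have /andP[x0 xi] := xb i; rewrite ler_pXn2r.
Qed.

Hypothesis N3 : (3 <= N)%N.

(* The decay exponent [(N - 2) / 2] is the one for which the mass of [u ^ q] on
   the cubes [[b, 2 b]^N], with [q] the Sobolev exponent, stays bounded below as
   [b] grows; far enough out, a test function vanishes on these cubes. *)
Lemma slow_decay_not_in_D12 (U : R -> R) (k : R) : 0 < k ->
  (forall r s, 0 <= r -> r <= s -> U s <= U r) -> (forall r, 0 <= r -> 0 < U r) ->
  (forall r, 1 <= r -> k <= U r ^+ 2 * r ^+ (N - 2)) ->
  ~ in_D12 (U \o @enorm R N).
Proof.
move=> k0 Udec U0 Uk [_ [phi [tphi _ phi_cvg]]].
have N0 : (0 < N)%N by exact: leq_trans N3.
pose m : R := N%:R - 2.
have mE : m = (N - 2)%:R by rewrite natrB// ltnW.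
have m0 : 0 < m by rewrite mE ltr0n subn_gt0.
pose q := sobolev_exponent R N.
have qE : q = 2 * (N%:R / m) by rewrite /q /sobolev_exponent mulrA.
have e0 : 0 < N%:R / m by rewrite divr_gt0// ltr0n.
have q0 : 0 < q by rewrite qE mulr_gt0.
(* On [[b, 2 b]^N] the Euclidean norm is at most [s * b], so the monotone profile is at least
   [U (s * b)] there. *)
pose s : R := Num.sqrt N%:R * 2.
have s0 : 0 < s by rewrite mulr_gt0// sqrtr_gt0 ltr0n.
have s1 : 1 <= s.
  rewrite /s -[leLHS]mulr1 ler_pM// ?ler01 ?ler1n//.
  by rewrite -[leLHS]sqrtr1 ler_wsqrtr// ler1n.
(* Raising the decay bound at [r = s * b] to the power [N / m] gives [k^(N/m) <= U(s b)^q (s b)^N],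
   since [q = 2 N / m]. *)
pose K := k `^ (N%:R / m) / s ^+ N.
have K0 : 0 < K by rewrite divr_gt0 ?powR_gt0// exprn_gt0.
have massK (b : R) : 1 <= b -> K <= U (s * b) `^ q * b ^+ N.
  move=> b1; have b0 : 0 < b by exact: lt_le_trans b1.
  have sb0 : 0 < s * b by rewrite mulr_gt0.
  have sb1 : 1 <= s * b by rewrite -[leLHS]mulr1 ler_pM// ler01.
  have := Uk _ sb1; have := U0 _ (ltW sb0); set v := U (s * b) => v0 kv.
  rewrite /K ler_pdivrMr ?exprn_gt0//.
  have -> : v `^ q * b ^+ N * s ^+ N = (v ^+ 2 * (s * b) ^+ (N - 2)) `^ (N%:R / m).
    rewrite powRM ?exprn_ge0 ?(ltW v0) ?(ltW sb0)//.
    have -> : (v ^+ 2) `^ (N%:R / m) = v `^ q.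
      by rewrite -powR_mulrn ?(ltW v0)// -powRrM -qE.
    have -> : ((s * b) ^+ (N - 2)) `^ (N%:R / m) = (s * b) ^+ N.
      rewrite -powR_mulrn ?(ltW sb0)// -powRrM -mE.
      have -> : m * (N%:R / m) = N%:R by rewrite mulrC divfK// gt_eqF.
      by rewrite powR_mulrn ?(ltW sb0).
    by rewrite [(s * b) ^+ N]exprMn mulrA mulrAC.
  apply: ge0_ler_powR => //; rewrite ?nnegrE; [exact: ltW|exact: ltW|].
  by rewrite mulr_ge0 ?exprn_ge0 ?(ltW v0) ?(ltW sb0).
have phi_ge j : ((K `^ q^-1)%:E <= LpN q (phi j \- (U \o @enorm R N))%R)%E.
  have [M phiM] := test_function_vanishes N0 (tphi j).
  (* [M <= b] makes [phi j] vanish on the cube, and [1 <= b] makes the decay bound applicable at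
     [s * b]. *)
  pose b := Num.max M 1.
  have b1 : 1 <= b by rewrite le_max lexx orbT.
  have b0 : 0 < b by exact: lt_le_trans b1.
  have v0 : 0 < U (s * b) by rewrite U0// mulr_ge0// ltW.
  apply: (@le_trans _ _ ((U (s * b) `^ q * (2 * b - b) ^+ N) `^ q^-1)%:E).
    rewrite lee_fin (_ : 2 * b - b = b); last by ring.
    apply: ge0_ler_powR; rewrite ?nnegrE ?invr_ge0 ?(ltW q0) ?(ltW K0) ?massK//.
    by rewrite mulr_ge0 ?powR_ge0 ?exprn_ge0 ?(ltW b0).
  apply: LpN_ge => //; [lra|exact: ltW|].
  move=> x xb; rewrite /= phiM; last first.
    by move=> i; have /andP[+ _] := xb i; apply: le_trans; rewrite le_max lexx.
  rewrite sub0r normrN ger0_norm; last by rewrite ltW// U0// enorm_ge0.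
  apply: Udec; first exact: enorm_ge0.
  rewrite /s -mulrA; apply: enorm_le_box; first by rewrite mulr_ge0// ltW.
  by move=> i; have /andP[bx ->] := xb i; rewrite (le_trans (ltW b0) bx).
have : ((K `^ q^-1)%:E <= limn (fun j => LpN q (phi j \- (U \o @enorm R N))%R))%E.
  apply: lime_ge; first by apply/cvg_ex; exists 0%E.
  by near=> j; exact: phi_ge.
rewrite (cvg_lim _ phi_cvg)//.
by rewrite lee_fin leNgt powR_gt0.
Unshelve. all: by end_near. Qed.

End slow_decay.

(** * Small data *)

Section small_data.
Context {R : realType} {N : nat} {p : R}.
Hypotheses (hN : (3 <= N)%N) (hp : sobolev_exponent R N - 1 < p).

Let c := N%:R / (p + 1).

Let N2 : 0 < N%:R - 2 :> R.
Proof. by rewrite subr_gt0 ltr_nat. Qed.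

Let N0 : 0 < N%:R :> R.
Proof. by rewrite ltr0n; exact: leq_trans hN. Qed.

(** The Sobolev exponent is at least [2]. *)
Lemma supercritical_gt1 : 1 < p.
Proof.
apply: le_lt_trans hp; rewrite lerBrDr /sobolev_exponent ler_pdivlMr//.
by lra.
Qed.

Let p1 : 0 < p + 1.
Proof. by have := supercritical_gt1; lra. Qed.

Let cE : c * (p + 1) = N%:R.
Proof. by rewrite /c divfK// gt_eqF. Qed.

(** Supercriticality, [p + 1 > 2 N / (N - 2)], expressed through [c]. *)
Let gap : 0 < N%:R - 2 - 2 * c.
Proof.
move: hp; rewrite ltrBlDr /sobolev_exponent ltr_pdivrMr// => H.
by rewrite subr_gt0 /c mulrA ltr_pdivrMr// [ltRHS]mulrC.
Qed.

Lemma small_data_solution : exists2 b : R, 0 < b & forall xi, 0 < xi <= b ->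
  exists u : 'rV[R]_N -> R,
    [/\ classical_solution p u, radial u, ~ in_D12 u & u 0 = xi].
Proof.
(* The bound [1] keeps the profile below the truncation level; the other gives [N%:R * xi] at most
   the gap, hence strictly less than twice the gap. *)
exists (Num.min 1 ((N%:R - 2 - 2 * c) / N%:R)); first by rewrite lt_min ltr01 divr_gt0.
move=> xi /andP[xi0]; rewrite le_min => /andP[xi1].
rewrite ler_pdivlMr// mulrC => xile.
have xis : N%:R * xi < 2 * (N%:R - 2 - 2 * c) by move: gap; lra.
have N0' : (0 < N)%N by exact: leq_trans hN.
pose g (x : R) := pospow p (Num.min x 1).
have gL x y : `|g x - g y| <= p * `|x - y|.
  by apply: pospow_lipschitz; exact: supercritical_gt1.
have [U [G [avgG cU U0 dU]]] := picard_fixpoint xi N0' (ltW supercritical_gt1) gL.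
have p_gt1 := supercritical_gt1.
exists (U \o @enorm R N); split.
- apply: (@radial_classical_solution _ N p (g \o U) U G) => //.
  + move=> x; apply: (@pcont_comp _ _ g U); first exact: cU.
    apply: (@pcont_comp _ _ (pospow p) (fun t : R => Num.min t 1)).
      by apply: continuous_min; [exact: cvg_id|exact: cst_continuous].
    rewrite -[p](subrK 1); apply: derivable_continuous.
    by apply: is_derive_pospow; rewrite subr_gt0.
  + exact: (profile_gt0 hN p_gt1 xi0 xi1 cE xis avgG cU U0 dU).
  + exact: (profile_source hN p_gt1 xi0 xi1 cE xis avgG cU U0 dU).
  + exact: (profile_vanishes hN p_gt1 xi0 xi1 avgG cU U0 dU).
- by exists U.
- have [k k0 Uk] := profile_lower_bound hN p_gt1 xi0 xi1 cE xis avgG cU U0 dU.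
  apply: (slow_decay_not_in_D12 hN k0) Uk.
    exact: (profile_nonincreasing hN avgG cU dU).
  exact: (profile_gt0 hN p_gt1 xi0 xi1 cE xis avgG cU U0 dU).
- by rewrite /= enorm0.
Qed.

End small_data.

Theorem theorem0p2 (R : realType) (N : nat) (p : R)
    (hN : (3 <= N)%N) (hp : sobolev_exponent R N - 1 < p) :
  infinite_set [set u : 'rV[R]_N -> R |
    [/\ classical_solution p u, radial u & ~ in_D12 u]].
Proof.
have [b b0 sol] := small_data_solution hN hp.
(* Infinitely many admissible heights; since [u 0] recovers the height, the corresponding solutions
   are pairwise distinct. *)
pose xi (n : nat) : R := b / n.+1%:R.
have xi_inj : injective xi.
  move=> i j /(mulfI (lt0r_neq0 b0))/invr_inj/eqP.
  by rewrite eqr_nat eqSS => /eqP.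
have {}sol n : exists u : 'rV[R]_N -> R,
    [/\ classical_solution p u, radial u, ~ in_D12 u & u 0 = xi n].
  by apply: sol; rewrite divr_gt0//= ler_pdivrMr// ler_peMr ?(ltW b0)// ler1n.
have [u uP] := choice sol.
have u_inj : injective u.
  move=> i j uij; apply: xi_inj.
  by have [_ _ _ <-] := uP i; have [_ _ _ <-] := uP j; rewrite uij.
move=> fin; apply: infinite_nat.
have : finite_set (range u) by apply: sub_finite_set fin => _ [n _ <-]; case: (uP n).
by rewrite (eq_finite_set (inj_card_eq (in2W u_inj))).
Qed.
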